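(* Let $\sigma>0$ and $\alpha\ge 1$ be fixed. Let $(p_n)$ be a sequence of integers with $0\le p_n\le n$, $p_n\to\infty$ and $p_n=o(n)$ as $n\to\infty$, and let $\tau=(p_n/n)^\alpha$. Suppose that, under $\mathbb{E}_{\theta_0}$, $Y\sim\mathcal{N}(\theta_0,\sigma^2 I_n)$. Then for every sequence $M_n\to\infty$, as $n\to\infty$, $$\sup_{\theta_0\in\ell_0[p_n]}\mathbb{E}_{\theta_0}\Pi_\tau\left(\theta:\|\theta-\theta_0\|^2>M_np_n\log\frac{n}{p_n}\ \Big|\ Y\right)\to 0$$ and $$\sup_{\theta_0\in\ell_0[p_n]}\mathbb{E}_{\theta_0}\Pi_\tau\left(\theta:\|\theta-T_\tau(Y)\|^2>M_np_n\log\frac{n}{p_n}\ \Big|\ Y\right)\to 0.$$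
   Context: $\ell_0[p_n]:=\{\theta\in\mathbb{R}^n:\#\{1\le i\le n:\theta_i\ne 0\}\le p_n\}$; $\|\cdot\|$ is the Euclidean norm on $\mathbb{R}^n$. Horseshoe prior with fixed parameter $\tau>0$: the pairs $(\lambda_i,\theta_i)$, $i=1,\dots,n$, are independent, $\lambda_i$ has the standard half-Cauchy distribution $C^+(0,1)$ on $(0,\infty)$, and $\theta_i\mid\lambda_i\sim\mathcal{N}(0,\sigma^2\tau^2\lambda_i^2)$. The posterior $\Pi_\tau(\cdot\mid Y)$ is the conditional law of $\theta=(\theta_1,\dots,\theta_n)$ given $Y$ when $Y\mid\theta\sim\mathcal{N}(\theta,\sigma^2I_n)$. The horseshoe estimator $T_\tau(y)=(T_\tau(y_1),\dots,T_\tau(y_n))$ is the posterior mean, $T_\tau(y_i)=\mathbb{E}[\theta_i\mid y_i,\tau]$ (the posterior factorizes over coordinates). *)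

(* Defs.v *)
From HB Require Import structures.
From mathcomp Require Import all_boot all_order all_algebra.
From mathcomp Require Import all_classical all_reals all_analysis.
From mathcomp Require Import measurable_realfun.

Set Implicit Arguments.
Unset Strict Implicit.
Unset Printing Implicit Defensive.

Import Order.TTheory GRing.Theory Num.Theory.
Import numFieldNormedType.Exports.

Local Open Scope classical_set_scope.
Local Open Scope ring_scope.

(* Product of probability measures on [n.-tuple T], i.e. the joint law of
   independent coordinates: [tcons_pair] maps (x, (z_1, ..., z_n)) to
   (x, z_1, ..., z_n), and [distribution] is the library's image measure. *)
Section product_prob.
Context d (T : measurableType d) (R : realType).

Definition tcons_pair n (x : T * n.-tuple T) : n.+1.-tuple T :=
  [the n.+1.-tuple T of x.1 :: x.2].

Lemma measurable_tcons_pair n : measurable_fun setT (@tcons_pair n).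
Proof. exact: measurable_cons. Qed.

HB.instance Definition _ n := isMeasurableFun.Build _ _ _ _ (@tcons_pair n)
  (@measurable_tcons_pair n).

Fixpoint product_prob n : ('I_n -> probability T R) ->
    probability (n.-tuple T) R :=
  match n with
  | 0 => fun=> \d_([tuple] : 0.-tuple T)
  | m.+1 => fun P => distribution
      (P ord0 \x product_prob (fun i => P (lift ord0 i)))%E (@tcons_pair m)
  end.

End product_prob.

Section half_cauchy.
Context (R : realType).
Notation mu := (@lebesgue_measure R).

Definition half_cauchy_pdf : R -> R :=
  (fun x => 2 / (pi * (1 + x ^+ 2))) \_ `]0, +oo[.

Definition half_cauchy_prob (V : set (measurableTypeR R)) : \bar R :=
  (\int[mu]_(x in V) (half_cauchy_pdf x)%:E)%E.

Lemma half_cauchy_pdf_ge0 x : 0 <= half_cauchy_pdf x.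
Proof.
apply: restrict_ge0 => {}x _.
by rewrite divr_ge0// mulr_ge0 ?pi_ge0// addr_ge0// sqr_ge0.
Qed.

Lemma measurable_half_cauchy_pdf : measurable_fun setT half_cauchy_pdf.
Proof.
apply/measurable_restrict => //; apply: measurable_funTS.
rewrite (_ : (fun x => _) = (fun x => 2 / pi * (oneDsqr x)^-1)); last first.
  by apply/funext => x; rewrite invfM mulrA.
apply: measurable_funM => //.
exact: (continuous_measurable_fun (@continuous_oneDsqrV R)).
Qed.

Lemma integral_half_cauchy_pdf : (\int[mu]_x (half_cauchy_pdf x)%:E = 1)%E.
Proof.
transitivity (\int[mu]_(x in `]0%R, +oo[) (2 / (pi * (1 + x ^+ 2)))%:E)%E.
  by rewrite [RHS]integral_mkcond; apply: eq_integral => x _;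
     rewrite /half_cauchy_pdf !patchE; case: ifP.
rewrite (_ : (fun x => _) = (fun x => (2 / pi)%:E * ((oneDsqr x)^-1)%:E)%E); last first.
  by apply/funext => x; rewrite -EFinM invfM mulrA.
have mf D : measurable_fun D (fun x : R => ((oneDsqr x)^-1)%:E).
  apply/measurable_EFinP/measurable_funTS.
  exact: (continuous_measurable_fun (@continuous_oneDsqrV R)).
have f0 (x : R) : (0 <= ((oneDsqr x)^-1)%:E)%E.
  by rewrite lee_fin invr_ge0 (le_trans _ (oneDsqr_ge1 x)).
have c0 : (0 <= (2 / pi : R)%:E)%E by rewrite lee_fin divr_ge0// pi_ge0.
rewrite ge0_integralZl//; last exact: mf.
rewrite integral_itv_obnd_cbnd; last exact: mf.
rewrite integral0y_oneDsqr -EFinM mulrA divfK ?gt_eqF ?pi_gt0//.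
by rewrite mulfV.
Qed.

Let half_cauchy0 : half_cauchy_prob set0 = 0%E.
Proof. by rewrite /half_cauchy_prob integral_set0. Qed.

Let half_cauchy_ge0 A : (0 <= half_cauchy_prob A)%E.
Proof. by apply: integral_ge0 => x _; rewrite lee_fin half_cauchy_pdf_ge0. Qed.

Let half_cauchy_sigma_additive : semi_sigma_additive half_cauchy_prob.
Proof.
move=> /= F mF tF mUF; rewrite /half_cauchy_prob; apply: cvg_toP.
  apply: ereal_nondecreasing_is_cvgn => m n mn.
  apply: lee_sum_nneg_natr => // k _ _; apply: integral_ge0 => /= x Fkx.
  by rewrite lee_fin half_cauchy_pdf_ge0.
rewrite ge0_integral_bigcup//=.
- apply/measurable_funTS/measurableT_comp => //.
  exact: measurable_half_cauchy_pdf.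
- by move=> x _; rewrite lee_fin half_cauchy_pdf_ge0.
Qed.

HB.instance Definition _ := isMeasure.Build _ _ _
  half_cauchy_prob half_cauchy0 half_cauchy_ge0 half_cauchy_sigma_additive.

Let half_cauchy_setT : half_cauchy_prob setT = 1%E.
Proof. exact: integral_half_cauchy_pdf. Qed.

HB.instance Definition _ :=
  Measure_isProbability.Build _ _ _ half_cauchy_prob half_cauchy_setT.

End half_cauchy.

Section horseshoe.
Context (R : realType).
Variables sigma tau : R.
Notation mu := (@lebesgue_measure R).

(* Marginal law of theta_i when lambda_i ~ C+(0,1) and
   theta_i | lambda_i ~ N(0, sigma^2 tau^2 lambda_i^2).  The second argument of
   [normal_prob] is the standard deviation; its value at the degenerate
   deviation 0 only matters on the null set l = 0 (when sigma * tau != 0). *)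
Definition horseshoe_prob (A : set (measurableTypeR R)) : \bar R :=
  (\int[half_cauchy_prob (R:=R)]_l normal_prob 0%R (sigma * tau * l)%R A)%E.

Lemma measurable_normal_prob_scale (A : set (measurableTypeR R)) :
  measurable A ->
  measurable_fun setT (fun l : measurableTypeR R => normal_prob 0 (sigma * tau * l) A).
Proof.
move=> mA.
rewrite (_ : (fun l => _) = fubini_F mu
  (fun x : R * R => (normal_pdf 0 (sigma * tau * x.1) x.2 * \1_A x.2)%:E));
  last first.
  apply/funext => l; rewrite /normal_prob /fubini_F/= integral_mkcond.
  by apply: eq_integral => x _; rewrite patchE indicE; case: ifPn;
     rewrite ?mulr1 ?mulr0.
apply: measurable_fun_fubini_tonelli_F => /=; last first.
  by move=> x; rewrite lee_fin mulr_ge0// normal_pdf_ge0.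
have mA2 : measurable_fun setT (fun x : R * R => \1_A x.2 : R).
  by apply: measurableT_comp => //; exact: measurable_indic.
have ms : measurable_fun setT (fun x : R * R => sigma * tau * x.1).
  exact: measurable_funM.
have ms2 (c : R) : 0 <= c ->
    measurable_fun setT (fun x : R * R => ((sigma * tau * x.1) ^+ 2 * c) `^ (-1)).
  move=> c0; apply: (measurableT_comp (@measurable_powR R (-1))).
  by apply: measurable_funM => //; exact: measurable_funX.
have sE (x : R) : (x ^+ 2 *+ 2)^-1 = (x ^+ 2 * 2) `^ (-1).
  by rewrite mulr_natr powR_inv1 ?mulrn_wge0 ?sqr_ge0.
apply/measurable_EFinP/measurable_funM => //.
rewrite /normal_pdf; apply: measurable_fun_ifT => //=.
- exact: measurable_fun_eqr.
- by apply: measurableT_comp => //; exact: measurable_indic.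
apply: measurable_funM.
  rewrite (_ : (fun x => _) = (fun x : R * R =>
      (((sigma * tau * x.1) ^+ 2 * (pi *+ 2)) `^ (-1)) `^ (2^-1))); last first.
    apply/funext => x; rewrite powR12_sqrt ?powR_ge0//.
    have x0 : 0 <= (sigma * tau * x.1) ^+ 2 * (pi *+ 2).
      by rewrite mulr_ge0 ?sqr_ge0// mulrn_wge0// pi_ge0.
    by rewrite powR_inv1// sqrtrV// (mulrnAr _ pi).
  apply: (measurableT_comp (f := @powR R ^~ 2^-1)) => //.
  by apply: ms2; rewrite mulrn_wge0// pi_ge0.
rewrite /normal_fun; apply: measurableT_comp => //=.
apply: measurable_funM => /=.
  under eq_fun do rewrite subr0.
  by apply: measurableT_comp => //; apply: measurable_funX.
by under eq_fun do rewrite sE; exact: ms2.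
Qed.

Let horseshoe0 : horseshoe_prob set0 = 0%E.
Proof. by rewrite /horseshoe_prob integral0_eq// => l _; rewrite measure0. Qed.

Let horseshoe_ge0 A : (0 <= horseshoe_prob A)%E.
Proof. by apply: integral_ge0. Qed.

Let horseshoe_sigma_additive : semi_sigma_additive horseshoe_prob.
Proof.
move=> F mF tF mUF; rewrite [X in _ --> X](_ : _ =
    \sum_(n <oo) horseshoe_prob (F n))%E; last first.
  rewrite -integral_nneseries//; last first.
    by move=> n; exact: measurable_normal_prob_scale.
  apply: eq_integral => l _; apply/esym/cvg_lim => //.
  exact: measure_semi_sigma_additive.
by apply: is_cvg_nneseries => *; exact: horseshoe_ge0.
Qed.

HB.instance Definition _ := isMeasure.Build _ _ _
  horseshoe_prob horseshoe0 horseshoe_ge0 horseshoe_sigma_additive.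

Let horseshoe_setT : horseshoe_prob setT = 1%E.
Proof.
rewrite /horseshoe_prob.
under eq_integral do rewrite probability_setT.
by rewrite integral_cst// mul1e; exact: probability_setT.
Qed.

HB.instance Definition _ :=
  Measure_isProbability.Build _ _ _ horseshoe_prob horseshoe_setT.

End horseshoe.

(* R^n.  The library puts [lebesgue_measure] and [normal_prob] on
   [measurableTypeR R], i.e. R with the sigma-algebra generated by the intervals
   ]a, b], whereas the measurable structure inferred for a bare [R] has another
   display; the measurable sets are the same. *)
Notation rvec R n := (n.-tuple (measurableTypeR R)).

Section posterior.
Context (R : realType) (n : nat).
Implicit Types (theta y : rvec R n) (sigma tau : R).

Definition coord theta (i : 'I_n) : R := tnth theta i.

(* N(theta, sigma^2 I_n) *)
Definition normal_vector theta sigma : probability (rvec R n) R :=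
  product_prob (fun i => normal_prob (coord theta i) sigma).

Definition horseshoe_prior sigma tau : probability (rvec R n) R :=
  product_prob (fun=> horseshoe_prob sigma tau).

(* [K] is a regular conditional law of theta given Y when theta follows the
   horseshoe prior and Y | theta ~ N(theta, sigma^2 I_n), i.e.
     E[1_B(Y) K(Y, A)] = P(theta in A, Y in B).
   Bayes' formula gives such a K; it is unique up to Lebesgue-null sets of y. *)
Definition is_posterior sigma tau (K : R.-pker rvec R n ~> rvec R n) : Prop :=
  forall A B : set (rvec R n), measurable A -> measurable B ->
    (\int[horseshoe_prior sigma tau]_theta
       \int[normal_vector theta sigma]_(y in B) K y A =
     \int[horseshoe_prior sigma tau]_(theta in A)
       normal_vector theta sigma B)%E.

Definition posterior_mean (K : R.-pker rvec R n ~> rvec R n) y : rvec R n :=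
  [tuple \int[K y]_theta coord theta i | i < n].

Definition euclidean_dist theta theta' : R :=
  Num.sqrt (\sum_(i < n) (coord theta i - coord theta' i) ^+ 2).

Definition l0_ball (k : nat) : set (rvec R n) :=
  [set theta | (#|[set i : 'I_n | coord theta i != 0%R]%SET| <= k)%N].

End posterior.

Arguments l0_ball : clear implicits.

(* Main.v *)
From HB Require Import structures.
From mathcomp Require Import all_boot all_order all_algebra.
From mathcomp Require Import all_classical all_reals all_analysis.
From mathcomp Require Import measurable_realfun ring lra.
Require Import Defs.

(** Everything follows from a bound on the posterior second moment.  Suppose
    that under Y ~ N(theta0, sigma^2 I) the expectation of the posterior mean of
    |theta - theta0|^2 is at most a constant times p ln (n / p), uniformly over
    the p-sparse theta0.  Markov's inequality then gives the first convergence.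
    It also gives the second one: for each y the posterior mean minimises
    c |-> E[|theta - c|^2 | y], so the second moment around T(y) is at most the
    one around theta0 ([posterior_mean_dist_le], [posterior_tail_le]).

    Reduction to one coordinate.  N(theta, sigma^2 I) has with respect to
    N(theta0, sigma^2 I) a density which is a product over the coordinates.
    Hence the identity that characterises a posterior K, tested on all B, says
    that for almost every y the number K(y, A) is given by Bayes' formula
    ([posterior_ae]).  The prior is a product too, so the posterior second
    moment of the i-th coordinate depends on y_i alone ([lik_moment_coord]) and
    the total risk is a sum of one-dimensional risks ([posterior_risk_le]).

    One coordinate.  With b = sigma tau, the prior density at t lies between
    c b / (b^2 + t^2) and 6 b / t^2 ([horseshoe_pdf_lb], [horseshoe_pdf_ub]).
    Let D(y) be the marginal density of the observation, up to a constant, and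
    L = ln (1 / tau).  The lower bound on the prior density gives both
    D(y) >= c tau / (1 + y^2) and D(y) >= c exp (- y^2 / (2 sigma^2)).
    - For every y, E[(theta - y)^2 | y] <= C L ([posterior_moment_obs]).  Indeed
      x <= ln A + e^x / A; take x = (theta - y)^2 / (4 sigma^2) and A of order
      1 / tau.  The integral of e^x against the posterior is a ratio of two
      marginal densities, the numerator having noise variance 2 sigma^2, and
      this ratio is at most A by the bound on D and by [flat_lik_ub].  So every
      coordinate has risk O(L).
    - If the true coordinate is 0, cut at |y| = zeta = 2 sigma sqrt L.  For
      |y| <= zeta the upper bound on the prior density makes the unnormalised
      second moment around 0 at most C tau; dividing by D(y) cancels the normal
      density of the observation, and what is left is C tau times the length of
      [-zeta, zeta].  The event |y| > zeta, weighted by the bound C L + 2 y^2,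
      contributes O(tau L) by a Chernoff bound.  So such a coordinate has risk
      O(tau L) ([posterior_coordinate_risk]).

    Summing up, the risk is at most C (p + n tau) L.  Since alpha >= 1 one has
    n tau <= p, and L = alpha ln (n / p); dividing by M_n p ln (n / p) leaves
    a constant over M_n ([rate_le]). *)

Set Implicit Arguments.
Unset Strict Implicit.
Unset Printing Implicit Defensive.

Import Order.TTheory GRing.Theory Num.Theory.
Import numFieldNormedType.Exports.

Local Open Scope classical_set_scope.
Local Open Scope ring_scope.

Ltac positivity := repeat first
  [ done | exact: expR_gt0 | exact: expR_ge0 | exact: pi_gt0 | exact: pi_ge0
  | exact: sqr_ge0 | apply: mulr_gt0 | apply: addr_gt0 | rewrite invr_gt0
  | apply: exprn_gt0 | apply: mulr_ge0 | apply: addr_ge0 | rewrite invr_ge0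
  | apply: exprn_ge0 | apply: ltW ].

(** * Integrals against mixtures and products of measures *)

Section integral_generic.
Local Open Scope ereal_scope.
Context (R : realType).

(** The integral of a nonnegative function is a supremum over the simple
    functions below it, hence monotone in the integrand without any
    measurability. This is used for y |-> K(y, A_y), where the set A_y depends
    on y. *)
Lemma ge0_le_integralT d (T1 : measurableType d)
    (mu : {measure set T1 -> \bar R}) (f g : T1 -> \bar R) :
  (forall x, 0 <= f x) -> (forall x, f x <= g x) ->
  \int[mu]_x f x <= \int[mu]_x g x.
Proof.
move=> f0 fg.
have g0 x : 0 <= g x by exact: le_trans (fg x).
rewrite !ge0_integralTE//; apply: ge_ereal_sup => _ [h hf <-].
by apply: ereal_sup_ubound; exists h => //= x; exact: le_trans (fg x).
Qed.

Import HBNNSimple.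

Section mixture.
Context d1 d2 (T1 : measurableType d1) (T2 : measurableType d2).
Variables (mu : {measure set T1 -> \bar R}) (nu : {measure set T2 -> \bar R}).
Variable k : T1 -> {measure set T2 -> \bar R}.
Hypothesis mk : forall U, measurable U -> measurable_fun setT (k ^~ U).
Hypothesis nuE : forall A, measurable A -> nu A = \int[mu]_x k x A.

Let mixture_nnsfun (f : {nnsfun T2 >-> R}) :
  \int[nu]_z (f z)%:E = \int[mu]_x (\int[k x]_z (f z)%:E).
Proof.
under eq_integral do rewrite fimfunE -fsumEFin//.
rewrite ge0_integral_fsum//; last 2 first.
  - by move=> r; exact/measurable_EFinP/measurableT_comp.
  - by move=> r z _; rewrite EFinM nnfun_muleindic_ge0.
under [in RHS]eq_integral.
  move=> x _.
  under eq_integral.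
    by move=> z _; rewrite fimfunE -fsumEFin//; over.
  rewrite /= ge0_integral_fsum//; last 2 first.
    - by move=> r; exact/measurable_EFinP/measurableT_comp.
    - by move=> r z _; rewrite EFinM nnfun_muleindic_ge0.
  under eq_fsbigr.
    move=> r _.
    rewrite (integralZl_indic _ (fun r => f @^-1` [set r]))//; last first.
      by move=> r0; rewrite preimage_nnfun0.
    rewrite integral_indic// setIT.
    over.
  over.
rewrite /= ge0_integral_fsum//; last 2 first.
  - by move=> r; apply: measurable_funeM; exact: mk.
  - move=> n y _.
    have := mulemu_ge0 (fun n => f @^-1` [set n]).
    by apply; exact: preimage_nnfun0.
apply: eq_fsbigr => r _.
rewrite (integralZl_indic _ (fun r => f @^-1` [set r]))//; last first.
  exact: preimage_nnfun0.
rewrite integral_indic// setIT nuE//.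
have [r0|r0] := leP 0%R r.
  by rewrite ge0_integralZl//; exact: mk.
rewrite preimage_nnfun0//; under eq_integral do rewrite measure0.
under [RHS]eq_integral do rewrite measure0 mule0.
by rewrite !integral0 mule0.
Qed.

(** Both sides are additive and monotone-continuous in [f], and they agree on
    indicators. *)
Lemma ge0_integral_mixture (f : T2 -> \bar R) :
  (forall z, 0 <= f z) -> measurable_fun setT f ->
  \int[nu]_z f z = \int[mu]_x (\int[k x]_z f z).
Proof.
move=> f0 mf; pose f_ := nnsfun_approx measurableT mf.
have fE (m : {measure set T2 -> \bar R}) :
    \int[m]_z f z = lim (\int[m]_z (f_ n z)%:E @[n --> \oo]).
  transitivity (\int[m]_z (lim ((f_ n z)%:E @[n --> \oo]))).
    apply: eq_integral => z _; apply/esym/cvg_lim => //.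
    exact: cvg_nnsfun_approx.
  rewrite monotone_convergence//.
  - by move=> n; exact/measurable_EFinP.
  - by move=> n z _; rewrite lee_fin.
  - by move=> z _ a b ab; rewrite lee_fin; exact/lefP/nd_nnsfun_approx.
rewrite fE; under eq_fun do rewrite mixture_nnsfun.
rewrite -monotone_convergence//; last 3 first.
- move=> n; apply: measurable_fun_integral_kernel => //.
  + by move=> z; rewrite lee_fin.
  + exact/measurable_EFinP.
- by move=> n y _; apply: integral_ge0 => // z _; rewrite lee_fin.
- move=> y _ a b ab; apply: ge0_le_integralT => z; rewrite lee_fin//.
  exact/lefP/nd_nnsfun_approx.
by apply: eq_integral => x _; rewrite fE.
Qed.

End mixture.
End integral_generic.

(** A density is a mixture of Dirac masses [p x * \d_x]. *)
Lemma ge0_integral_density d (T : measurableType d) (R : realType)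
    (mu nu : {measure set T -> \bar R}) (p : T -> R) (f : T -> \bar R) :
  (forall x, 0 <= p x) -> measurable_fun setT p ->
  (forall A, measurable A -> nu A = \int[mu]_(x in A) (p x)%:E)%E ->
  (forall x, 0 <= f x)%E -> measurable_fun setT f ->
  (\int[nu]_x f x = \int[mu]_x ((p x)%:E * f x))%E.
Proof.
move=> p0 mp nuE f0 mf.
pose k x : {measure set T -> \bar R} := mscale (NngNum (p0 x)) (dirac x).
have kE x A : k x A = (p x * \1_A x)%:E.
  by rewrite /k /= /mscale/= diracE indicE EFinM.
rewrite (@ge0_integral_mixture _ _ _ _ _ mu nu k)//.
- apply: eq_integral => x _.
  rewrite /k ge0_integral_mscale//= integral_dirac//.
  by rewrite diracT mul1e.
- move=> U mU; under eq_fun do rewrite kE.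
  by apply/measurable_EFinP/measurable_funM => //; exact: measurable_indic.
- move=> A mA; rewrite nuE// integral_mkcond; apply: eq_integral => x _.
  by rewrite kE patchE indicE; case: ifPn; rewrite ?mulr1 ?mulr0.
Qed.

Section product_prob_integral.
Local Open Scope ereal_scope.
Context d (T : measurableType d) (R : realType).

Lemma ge0_integral_product_probS n (P : 'I_n.+1 -> probability T R)
    (f : n.+1.-tuple T -> \bar R) :
  (forall x, 0 <= f x) -> measurable_fun setT f ->
  \int[product_prob P]_x f x =
  \int[P ord0]_x \int[product_prob (fun i => P (lift ord0 i))]_z
     f (tcons_pair (x, z)).
Proof.
move=> f0 mf; rewrite /= ge0_integral_pushforward//=.
rewrite preimage_setT fubini_tonelli1//.
exact: (measurableT_comp mf (@measurable_tcons_pair _ _ _)).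
Qed.

Lemma tnth_tcons0 n (x : T) (z : n.-tuple T) :
  tnth (tcons_pair (x, z)) ord0 = x.
Proof. by []. Qed.

Lemma tnth_tconsS n (x : T) (z : n.-tuple T) i :
  tnth (tcons_pair (x, z)) (lift ord0 i) = tnth z i.
Proof. exact: tnthS. Qed.

Lemma emeasurable_prod d' (S : measurableType d') (I : Type) (s : seq I)
    (f : I -> S -> \bar R) :
  (forall i, measurable_fun setT (f i)) ->
  measurable_fun setT (fun x => \big[*%E/1]_(i <- s) f i x).
Proof.
move=> mf; elim: s => [|i s IHs].
  by under eq_fun do rewrite big_nil; exact: measurable_cst.
by under eq_fun do rewrite big_cons; exact: emeasurable_funM.
Qed.

(** Independence in the form used here: the expectation of a product of
    functions of distinct coordinates is the product of the expectations. *)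
Lemma ge0_integral_product_prob_prod n (P : 'I_n -> probability T R)
    (f : 'I_n -> T -> \bar R) :
  (forall i x, 0 <= f i x) -> (forall i, measurable_fun setT (f i)) ->
  \int[product_prob P]_x \big[*%E/1]_(i < n) f i (tnth x i) =
  \big[*%E/1]_(i < n) \int[P i]_x f i x.
Proof.
elim: n P f => [|n IHn] P f f0 mf.
  rewrite big_ord0; under eq_integral do rewrite big_ord0.
  by rewrite integral_cst//= mul1e diracT.
have mprod m (g : 'I_m -> T -> \bar R) :
    (forall i, measurable_fun setT (g i)) ->
    measurable_fun setT
      (fun x : m.-tuple T => \big[*%E/1]_(i < m) g i (tnth x i)).
  move=> mg; apply: emeasurable_prod => i.
  exact: (measurableT_comp (mg i) (measurable_tnth i)).
rewrite ge0_integral_product_probS;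
  [|by move=> x; exact: prode_ge0|exact: mprod].
rewrite big_ord_recl -IHn//.
under eq_integral => x _.
  under eq_integral => z _.
    rewrite big_ord_recl tnth_tcons0; under eq_bigr do rewrite tnth_tconsS.
    over.
  rewrite ge0_integralZl//;
    [|exact: (mprod _ (fun i => f (lift ord0 i)))|
      by move=> *; exact: prode_ge0].
  over.
rewrite ge0_integralZr//.
by apply: integral_ge0 => x _; exact: prode_ge0.
Qed.

(** The hypothesis on each factor is stated with integrals rather than
    densities of sets so that the induction can apply it to partial
    integrals. *)
Lemma ge0_integral_product_prob_density n (P Q : 'I_n -> probability T R)
    (l : 'I_n -> T -> R) (f : n.-tuple T -> \bar R) :
  (forall i x, (0 <= l i x)%R) -> (forall i, measurable_fun setT (l i)) ->
  (forall i g, (forall x, 0 <= g x) -> measurable_fun setT g ->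
     \int[Q i]_x g x = \int[P i]_x ((l i x)%:E * g x)) ->
  (forall x, 0 <= f x) -> measurable_fun setT f ->
  \int[product_prob Q]_x f x =
  \int[product_prob P]_x ((\prod_(i < n) l i (tnth x i))%:E * f x).
Proof.
elim: n P Q l f => [|n IHn] P Q l f l0 ml QE f0 mf.
  by under [RHS]eq_integral do rewrite big_ord0 mul1e.
have mL m (g : 'I_m -> T -> R) : (forall i, measurable_fun setT (g i)) ->
    measurable_fun setT (fun x : m.-tuple T => \prod_(i < m) g i (tnth x i))%R.
  move=> mg; apply: measurable_prod => i _.
  exact: (measurableT_comp (mg i) (measurable_tnth i)).
pose P' := fun i => P (lift ord0 i).
have mLf : measurable_fun setT
    (fun x => (\prod_(i < n.+1) l i (tnth x i))%:E * f x).
  by apply: emeasurable_funM => //; apply/measurable_EFinP; exact: mL.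
have mft : measurable_fun setT (fun xz => f (@tcons_pair _ T n xz)).
  exact: (measurableT_comp mf (@measurable_tcons_pair _ _ _)).
have mft1 x : measurable_fun setT (fun z => f (@tcons_pair _ T n (x, z))).
  exact: (measurableT_comp mft (measurable_pair1 _)).
rewrite !ge0_integral_product_probS//; last first.
  by move=> x; apply: mule_ge0 => //; rewrite lee_fin; exact: prodr_ge0.
under eq_integral => x _.
  rewrite (IHn P' (fun i => Q (lift ord0 i)) (fun i => l (lift ord0 i)))//;
    last by move=> i g; exact: QE.
  over.
rewrite QE//=.
- apply: eq_integral => x _.
  rewrite -ge0_integralZl ?lee_fin//.
  + apply: eq_integral => z _.
    rewrite big_ord_recl tnth_tcons0 EFinM muleA.
    by under [in RHS]eq_bigr do rewrite tnth_tconsS.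
  + apply: emeasurable_funM => //; apply/measurable_EFinP.
    exact: (mL _ (fun i => l (lift ord0 i))).
  + by move=> z _; apply: mule_ge0 => //; rewrite lee_fin; exact: prodr_ge0.
- move=> x; apply: integral_ge0 => z _; apply: mule_ge0 => //.
  by rewrite lee_fin; exact: prodr_ge0.
- apply: (measurable_fun_fubini_tonelli_F (m2 := product_prob P')
    (fun xz => (\prod_(i < n) l (lift ord0 i) (tnth xz.2 i))%:E *
      f (tcons_pair xz))).
  + apply: emeasurable_funM => //; apply/measurable_EFinP.
    exact: (measurableT_comp (mL _ (fun i => l (lift ord0 i)) _) measurable_snd).
  + by move=> xz; apply: mule_ge0 => //; rewrite lee_fin; exact: prodr_ge0.
Qed.

Lemma ge0_integral_product_prob_tnth n (P : 'I_n -> probability T R) i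
    (f : T -> \bar R) : (forall x, 0 <= f x) -> measurable_fun setT f ->
  \int[product_prob P]_x f (tnth x i) = \int[P i]_x f x.
Proof.
move=> f0 mf; pose F j : T -> \bar R := if j == i then f else cst 1.
have F0 j x : 0 <= F j x by rewrite /F; case: ifPn.
have mF j : measurable_fun setT (F j) by rewrite /F; case: ifPn.
transitivity (\int[product_prob P]_x \prod_(j < n) F j (tnth x j)).
  apply: eq_integral => x _; rewrite (bigD1 i)//= big1 ?mule1 /F ?eqxx//.
  by move=> j /negbTE ->.
rewrite ge0_integral_product_prob_prod// (bigD1 i)//= big1 ?mule1 /F ?eqxx//.
move=> j /negbTE ->.
by rewrite integral_cst//= mul1e; exact: probability_setT.
Qed.

End product_prob_integral.

(** * Gaussian integrals *)

Section gaussian_integral.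
Context (R : realType).
Notation mu := (@lebesgue_measure R).

Definition gauss (c u : R) : R := expR (- u ^+ 2 / c).

Lemma gauss_ge0 (c u : R) : 0 <= gauss c u. Proof. exact: expR_ge0. Qed.

Lemma measurable_gauss (c : R) : measurable_fun setT (gauss c).
Proof.
apply: measurableT_comp => //; apply: measurable_funM => //.
by apply: measurableT_comp => //; exact: measurable_funX.
Qed.

Lemma normal_pdf_gauss (s m x : R) : 0 < s ->
  normal_pdf m s x = (Num.sqrt (s ^+ 2 * 2 * pi))^-1 * gauss (2 * s ^+ 2) (x - m).
Proof.
move=> s0; rewrite normal_pdfE ?gt_eqF//; congr ((Num.sqrt _)^-1 * _).
  by rewrite -mulr_natr mulrAC.
by rewrite /normal_fun /gauss -mulr_natl.
Qed.

Lemma integral_gauss (c m : R) : 0 < c ->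
  (\int[mu]_x (gauss c (x - m))%:E = (Num.sqrt (c * pi))%:E)%E.
Proof.
move=> c0; pose s := Num.sqrt (c / 2).
have s0 : 0 < s by rewrite sqrtr_gt0 divr_gt0.
have cE : 2 * s ^+ 2 = c by rewrite sqr_sqrtr ?divr_ge0 ?ltW// mulrC divfK.
have q0 : 0 < Num.sqrt (c * pi) by rewrite sqrtr_gt0 mulr_gt0 ?pi_gt0.
have pE x : normal_pdf m s x = (Num.sqrt (c * pi))^-1 * gauss c (x - m).
  by rewrite normal_pdf_gauss// cE (mulrC _ 2) cE.
have := integral_normal_pdf m s.
under eq_integral do rewrite pE EFinM.
rewrite ge0_integralZl//; last 2 first.
- apply/measurable_EFinP; apply: (measurableT_comp (@measurable_gauss c)).
  exact: measurable_funB.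
- by move=> x _; rewrite lee_fin gauss_ge0.
move=> /(congr1 (fun z => (Num.sqrt (c * pi))%:E * z)%E).
by rewrite muleA -EFinM divff ?gt_eqF// mul1e mule1.
Qed.

(** [powR] with exponent -1 is the inverse on nonnegative reals only, hence the
    detour by x * (x^2)^-1. *)
Lemma measurable_invr : measurable_fun setT (@GRing.inv R).
Proof.
rewrite (_ : GRing.inv = fun x => x * (x ^+ 2) `^ (-1)).
  apply: measurable_funM => //.
  apply: (measurableT_comp (@measurable_powR R (-1))); exact: measurable_funX.
apply/funext => x; rewrite powR_inv1 ?sqr_ge0// expr2.
have [->|x0] := eqVneq x 0; first by rewrite invr0 mul0r.
by rewrite invfM mulrA divff// mul1r.
Qed.

Lemma ge0_integral_normal_prob (m s : R) (f : R -> \bar R) :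
  (forall x, 0 <= f x)%E -> measurable_fun setT f ->
  (\int[normal_prob m s]_x f x = \int[mu]_x ((normal_pdf m s x)%:E * f x))%E.
Proof.
move=> f0 mf; apply: ge0_integral_density => //.
- exact: normal_pdf_ge0.
- exact: measurable_normal_pdf.
Qed.

Lemma ge0_integral_half_cauchy (f : R -> \bar R) :
  (forall x, 0 <= f x)%E -> measurable_fun setT f ->
  (\int[half_cauchy_prob (R:=R)]_x f x =
   \int[mu]_x ((half_cauchy_pdf x)%:E * f x))%E.
Proof.
move=> f0 mf; apply: ge0_integral_density => //.
- exact: half_cauchy_pdf_ge0.
- exact: measurable_half_cauchy_pdf.
Qed.

End gaussian_integral.

(** * The density of the horseshoe prior *)

Section half_cauchy_density.
Context (R : realType).

Lemma half_cauchy_pdf_le0 (l : R) : l <= 0 -> half_cauchy_pdf l = 0.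
Proof.
move=> l0; rewrite /half_cauchy_pdf patchE ifF//; apply/negbTE.
by rewrite notin_setE/= in_itv/= andbT ltNge l0.
Qed.

Lemma half_cauchy_pdf_gt0E (l : R) : 0 < l ->
  half_cauchy_pdf l = 2 / (pi * (1 + l ^+ 2)).
Proof.
move=> l0; rewrite /half_cauchy_pdf patchE ifT//.
by rewrite inE/= in_itv/= andbT.
Qed.

End half_cauchy_density.

Section horseshoe_density.
Context (R : realType).
Notation mu := (@lebesgue_measure R).
Variables sigma tau : R.
Hypothesis sigma_gt0 : 0 < sigma.
Hypothesis tau_gt0 : 0 < tau.
Let b := sigma * tau.

Let b_gt0 : 0 < b. Proof. exact: mulr_gt0. Qed.

(** Joint density of (lambda, theta), written without the case distinction that
    [normal_pdf] makes for a zero deviation. *)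
Definition horseshoe_joint_pdf (l t : R) : R :=
  half_cauchy_pdf l *
  ((Num.sqrt (2 * pi))^-1 * (b * l)^-1 * expR (- t ^+ 2 / (2 * (b * l) ^+ 2))).

Lemma horseshoe_joint_pdfE l t :
  horseshoe_joint_pdf l t = half_cauchy_pdf l * normal_pdf 0 (sigma * tau * l) t.
Proof.
rewrite /horseshoe_joint_pdf -/b.
have [l0|l0] := leP l 0; first by rewrite half_cauchy_pdf_le0// !mul0r.
have bl0 : 0 < b * l by rewrite mulr_gt0.
rewrite normal_pdf_gauss// -(mulrA (_ ^+ 2)) (sqrtrM _ (sqr_ge0 _)).
by rewrite sqrtr_sqr gtr0_norm// (invfM (b * l)) (mulrC (b * l)^-1) /gauss subr0.
Qed.

Lemma horseshoe_joint_pdf_ge0 l t : 0 <= horseshoe_joint_pdf l t.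
Proof.
by rewrite horseshoe_joint_pdfE mulr_ge0 ?half_cauchy_pdf_ge0 ?normal_pdf_ge0.
Qed.

Lemma measurable_horseshoe_joint_pdf :
  measurable_fun setT (fun lt : R * R => horseshoe_joint_pdf lt.1 lt.2).
Proof.
have mbl : measurable_fun setT (fun lt : R * R => b * lt.1).
  exact: measurable_funM.
apply: measurable_funM.
  exact: (measurableT_comp (@measurable_half_cauchy_pdf R)).
apply: measurable_funM.
  apply: measurable_funM => //.
  exact: (measurableT_comp (@measurable_invr R)).
apply: measurableT_comp => //; apply: measurable_funM.
  by apply: measurableT_comp => //; exact: measurable_funX.
apply: (measurableT_comp (@measurable_invr R)).
by apply: measurable_funM => //; exact: measurable_funX.
Qed.

(** Extended-real valued because the horseshoe density has a pole at 0. *)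
Definition horseshoe_pdf (t : R) : \bar R :=
  (\int[mu]_l (horseshoe_joint_pdf l t)%:E)%E.

Lemma horseshoe_pdf_ge0 t : (0 <= horseshoe_pdf t)%E.
Proof.
by apply: integral_ge0 => l _; rewrite lee_fin horseshoe_joint_pdf_ge0.
Qed.

Lemma ge0_integral_horseshoe (f : R -> \bar R) :
  (forall x, 0 <= f x)%E -> measurable_fun setT f ->
  (\int[horseshoe_prob sigma tau]_t f t = \int[mu]_t (f t * horseshoe_pdf t))%E.
Proof.
move=> f0 mf.
pose F (lt : R * R) := (f lt.2 * (horseshoe_joint_pdf lt.1 lt.2)%:E)%E.
have F0 lt : (0 <= F lt)%E.
  by rewrite mule_ge0// lee_fin horseshoe_joint_pdf_ge0.
have mF : measurable_fun setT F.
  apply: emeasurable_funM; first exact: (measurableT_comp mf).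
  by apply/measurable_EFinP; exact: measurable_horseshoe_joint_pdf.
rewrite (ge0_integral_mixture (mu := half_cauchy_prob (R:=R))
  (k := fun l => normal_prob 0 (sigma * tau * l)))//; last first.
  exact: measurable_normal_prob_scale.
rewrite ge0_integral_half_cauchy; last 2 first.
- by move=> l; exact: integral_ge0.
- apply: measurable_fun_integral_kernel => //.
  exact: measurable_normal_prob_scale.
transitivity (\int[mu]_l \int[mu]_t F (l, t))%E.
  apply: eq_integral => l _.
  rewrite ge0_integral_normal_prob// -ge0_integralZl//.
  + apply: eq_integral => t _.
    by rewrite /F/= horseshoe_joint_pdfE EFinM muleA muleC.
  + apply: emeasurable_funM => //; apply/measurable_EFinP.
    exact: measurable_normal_pdf.
  + by move=> t _; rewrite mule_ge0// lee_fin normal_pdf_ge0.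
  + by rewrite lee_fin half_cauchy_pdf_ge0.
rewrite (fubini_tonelli (m1 := mu) (m2 := mu) F)//.
apply: eq_integral => t _; rewrite /horseshoe_pdf -ge0_integralZl//.
- apply/measurable_EFinP.
  exact: (measurableT_comp measurable_horseshoe_joint_pdf (measurable_pair2 _)).
- by move=> l _; rewrite lee_fin horseshoe_joint_pdf_ge0.
Qed.

End horseshoe_density.

Section horseshoe_density_bounds.
Context (R : realType).
Notation mu := (@lebesgue_measure R).

Lemma integral_sqrVy (r : R) : 0 < r ->
  (\int[mu]_(x in `[r, +oo[) ((x ^+ 2)^-1)%:E = (r^-1)%:E)%E.
Proof.
move=> r0; pose F : R^o -> R^o := - (@GRing.inv R : R^o -> R^o).
have dF (x : R) : x != 0 -> is_derive (x : R^o) 1 F ((x ^+ 2)^-1).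
  move=> x0.
  have dV : is_derive (x : R^o) 1 (@GRing.inv R : R^o -> R^o) (- x ^- 2 *: 1).
    by apply: is_deriveV.
  have h := is_deriveN dV; apply: (is_derive_eq h).
  by rewrite scaleNr opprK /GRing.scale/= mulr1.
have cf (x : R) : x != 0 -> {for x, continuous (fun x : R => (x ^+ 2)^-1)}.
  move=> x0; apply: continuousV; first by rewrite sqrf_eq0.
  exact: exprn_continuous.
have cF (x : R) : x != 0 -> {for x, continuous F}.
  by move=> x0; apply: (@continuousN _ R^o); exact: inv_continuous.
rewrite (@ge0_continuous_FTC2y _ _ F _ 0).
- by rewrite sub0e /F -EFinN opprK.
- by move=> x _; rewrite invr_ge0 sqr_ge0.
- apply/continuous_within_itvcyP; split.
    move=> x; rewrite in_itv/= andbT => rx; apply: cf.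
    by rewrite gt_eqF// (lt_trans r0).
  by apply: cvg_at_right_filter; apply: cf; rewrite gt_eqF.
- rewrite -oppr0; apply: cvgN; apply/gtr0_cvgV0; last exact: cvg_id.
  by near=> x; near: x; exact: nbhs_pinfty_gt.
- move=> x rx; have x0 : x != 0 by rewrite gt_eqF// (lt_trans r0).
  by have [] := dF _ x0.
- by apply: cvg_at_right_filter; apply: cF; rewrite gt_eqF.
- move=> x; rewrite in_itv/= andbT => rx.
  have x0 : x != 0 by rewrite gt_eqF// (lt_trans r0).
  by rewrite derive1E; have [] := dF _ x0.
Unshelve. all: by end_near. Qed.

Variables sigma tau : R.
Hypothesis sigma_gt0 : 0 < sigma.
Hypothesis tau_gt0 : 0 < tau.
Let b := sigma * tau.

Let b_gt0 : 0 < b. Proof. exact: mulr_gt0. Qed.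

Let sqrt2pi_ge1 : 1 <= Num.sqrt (2 * pi) :> R.
Proof.
rewrite -[leLHS]sqrtr1 ler_wsqrtr//; have := @pi_ge2 R; lra.
Qed.

(** The number [r] is the scale at which the Gaussian factor becomes of order
    1. *)
Lemma horseshoe_joint_pdf_ub l t r : 0 < l -> 0 < r ->
  r ^+ 2 = t ^+ 2 / (2 * b ^+ 2) ->
  horseshoe_joint_pdf sigma tau l t <=
  b^-1 * (l^-1 * l^-1 ^+ 2 * expR (- (r / l) ^+ 2)).
Proof.
move=> l0 r0 rE; rewrite /horseshoe_joint_pdf -/b.
have -> : - t ^+ 2 / (2 * (b * l) ^+ 2) = - (r / l) ^+ 2.
  by rewrite expr_div_n rE; field; rewrite !gt_eqF.
have hcub : half_cauchy_pdf l <= l^-1 ^+ 2.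
  rewrite /half_cauchy_pdf patchE; case: ifPn => _; last exact: sqr_ge0.
  rewrite ler_pdivrMr ?mulr_gt0 ?pi_gt0 ?addr_gt0 ?exprn_gt0//.
  rewrite exprVn mulrC ler_pdivlMr ?exprn_gt0//.
  have := @pi_ge2 R; have := sqr_ge0 l; nra.
have c1 : half_cauchy_pdf l * (Num.sqrt (2 * pi))^-1 <= l^-1 ^+ 2.
  apply: le_trans hcub; rewrite ler_piMr ?half_cauchy_pdf_ge0//.
  by rewrite invf_le1 ?(lt_le_trans ltr01).
have e0 := expR_ge0 (- (r / l) ^+ 2).
rewrite [leLHS](_ : _ = half_cauchy_pdf l * (Num.sqrt (2 * pi))^-1 *
    (b^-1 * (l^-1 * expR (- (r / l) ^+ 2)))); last by rewrite invfM; ring.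
rewrite [leRHS](_ : _ = l^-1 ^+ 2 * (b^-1 * (l^-1 * expR (- (r / l) ^+ 2))));
  last by ring.
apply: ler_wpM2r => //; apply: mulr_ge0; first by rewrite invr_ge0 ltW.
by apply: mulr_ge0 => //; rewrite invr_ge0 ltW.
Qed.


(** Two regimes for the scale [l]: up to [r] the Gaussian factor beats any
    power of [l], by exp x >= x^2 / 2 at x = (r / l)^2; beyond [r] it is
    dropped. The integral of the right-hand side over [l] is of order r^-2. *)
Lemma inv_cube_gauss_ub (l r : R) : 0 < l -> 0 < r ->
  l^-1 * l^-1 ^+ 2 * expR (- (r / l) ^+ 2) <=
  2 * r^-1 ^+ 3 * \1_`]0, r] l + r^-1 * ((l ^+ 2)^-1 * \1_`[r, +oo[ l).
Proof.
move=> l0 r0.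
have li : 0 < l^-1 by rewrite invr_gt0.
have ri : 0 < r^-1 by rewrite invr_gt0.
have [lr|rl] := leP l r.
  rewrite [X in _ <= X + _](_ : _ = 2 * r^-1 ^+ 3); last first.
    by rewrite indicE mem_set ?mulr1//= in_itv/= l0.
  apply: ler_wpDr.
    by rewrite mulr_ge0 ?(ltW ri)// mulr_ge0 ?invr_ge0 ?sqr_ge0.
  have e1 : expR (- (r / l) ^+ 2) <= 2 * (l / r) ^+ 4.
    rewrite expRN -[leRHS]invrK lef_pV2 ?posrE ?invr_gt0 ?expR_gt0//; last first.
      by rewrite mulr_gt0// exprn_gt0// divr_gt0.
    have := @expR_ge1Dxn R ((r / l) ^+ 2) 1 (sqr_ge0 _).
    apply: le_trans; rewrite (_ : _^-1 = (r / l) ^+ 2 ^+ 2 / 2); last first.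
      by field; rewrite !gt_eqF.
    by rewrite lerDr ler01.
  apply: (le_trans (ler_wpM2l _ e1)); first by rewrite mulr_ge0 ?sqr_ge0 ?ltW.
  rewrite [leLHS](_ : _ = 2 * r^-1 ^+ 3 * (l / r)); last first.
    by field; rewrite !gt_eqF.
  apply: ler_piMr; first by rewrite mulr_ge0 ?exprn_ge0 ?(ltW ri).
  by rewrite ler_pdivrMr ?mul1r.
apply: ler_wpDl; first by rewrite !mulr_ge0 ?exprn_ge0 ?(ltW ri).
rewrite indicE mem_set ?mulr1/=; last by rewrite in_itv/= (ltW rl).
rewrite -exprVn -[leRHS]mulr1; apply: ler_pM => //.
- by rewrite mulr_ge0 ?sqr_ge0 ?ltW.
- by rewrite ler_wpM2r ?sqr_ge0// lef_pV2 ?posrE// ltW.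
- by rewrite -expR0 ler_expR oppr_le0 sqr_ge0.
Qed.

(** The horseshoe prior has Cauchy-like tails b / t^2: integrate the bound
    [inv_cube_gauss_ub] over the local scale. *)
Lemma horseshoe_pdf_ub t :
  ((t ^+ 2)%:E * horseshoe_pdf sigma tau t <= (6 * b)%:E)%E.
Proof.
have [->|t0] := eqVneq t 0.
  by rewrite expr0n/= mul0e lee_fin mulr_ge0 ?ltW.
pose r := Num.sqrt (t ^+ 2 / (2 * b ^+ 2)).
have t2 : 0 < t ^+ 2 by rewrite exprn_even_gt0.
have b2 : 0 < 2 * b ^+ 2 by rewrite mulr_gt0 ?exprn_gt0.
have r0 : 0 < r by rewrite sqrtr_gt0 divr_gt0.
have rE : r ^+ 2 = t ^+ 2 / (2 * b ^+ 2) by rewrite sqr_sqrtr// divr_ge0 ?ltW.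
pose A l := (2 * r^-1 ^+ 3 * \1_`]0, r] l)%:E.
pose B l := (r^-1 * ((l ^+ 2)^-1 * \1_`[r, +oo[ l))%:E.
have A0 l : (0 <= A l)%E.
  by rewrite lee_fin mulr_ge0// mulr_ge0// exprn_ge0// invr_ge0 ltW.
have B0 l : (0 <= B l)%E.
  by rewrite lee_fin mulr_ge0 ?invr_ge0 ?(ltW r0)// mulr_ge0// invr_ge0 sqr_ge0.
have mA : measurable_fun setT A.
  by apply/measurable_EFinP; apply: measurable_funM => //; exact: measurable_indic.
have msq : measurable_fun setT (fun l : R => (l ^+ 2)^-1).
  by apply: (measurableT_comp (@measurable_invr R)); exact: measurable_funX.
have mB : measurable_fun setT B.
  apply/measurable_EFinP; apply: measurable_funM => //.
  by apply: measurable_funM => //; exact: measurable_indic.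
have iA : (\int[mu]_l A l = (2 * r^-1 ^+ 2)%:E)%E.
  under eq_integral do rewrite /A EFinM.
  rewrite ge0_integralZl//; last 2 first.
  - by apply/measurable_EFinP; exact: measurable_indic.
  - by rewrite lee_fin mulr_ge0// exprn_ge0// invr_ge0 ltW.
  rewrite integral_indic//= setIT lebesgue_measure_itv/= lte_fin r0 -EFinB subr0.
  by rewrite -EFinM; congr EFin; field; rewrite gt_eqF.
have iB : (\int[mu]_l B l = (r^-1 ^+ 2)%:E)%E.
  under eq_integral do rewrite /B EFinM.
  rewrite ge0_integralZl//; last 3 first.
  - apply/measurable_EFinP.
    by apply: measurable_funM => //; exact: measurable_indic.
  - by move=> x _; rewrite lee_fin mulr_ge0// invr_ge0 sqr_ge0.
  - by rewrite lee_fin invr_ge0 ltW.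
  rewrite [X in (_ * X)%E](_ : _ = (r^-1)%:E) ?expr2//.
  rewrite -integral_sqrVy// [RHS]integral_mkcond; apply: eq_integral => x _.
  by rewrite patchE indicE; case: ifPn; rewrite ?mulr1 ?mulr0.
have ub : (horseshoe_pdf sigma tau t <= (b^-1)%:E * (3 * r^-1 ^+ 2)%:E)%E.
  have -> : (3 * r^-1 ^+ 2)%:E = (\int[mu]_l (A l + B l))%E.
    by rewrite ge0_integralD// iA iB -EFinD; congr EFin; ring.
  rewrite -ge0_integralZl//; last 3 first.
  - exact: emeasurable_funD.
  - by move=> l _; rewrite adde_ge0.
  - by rewrite lee_fin invr_ge0 ltW.
  apply: ge0_le_integralT => l; first by rewrite lee_fin horseshoe_joint_pdf_ge0.
  have [l0|l0] := leP l 0.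
    rewrite {1}/horseshoe_joint_pdf half_cauchy_pdf_le0// mul0r.
    by rewrite mule_ge0 ?adde_ge0// lee_fin invr_ge0 ltW.
  rewrite -EFinD -EFinM lee_fin.
  apply: (le_trans (horseshoe_joint_pdf_ub l0 r0 rE)).
  by rewrite ler_wpM2l ?invr_ge0 ?(ltW b_gt0)// inv_cube_gauss_ub.
apply: (le_trans (lee_wpmul2l _ ub)); first by rewrite lee_fin sqr_ge0.
rewrite -!EFinM lee_fin exprVn rE.
have -> : t ^+ 2 * (b^-1 * (3 * (t ^+ 2 / (2 * b ^+ 2))^-1)) = 6 * b.
  by field; rewrite t0 gt_eqF.
by [].
Qed.

(** Product of the constants of the half-Cauchy density, of the normal density
    and of its exponential factor on the range of scales used below. *)
Definition horseshoe_lb_const : R :=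
  (5 * pi)^-1 * (Num.sqrt (2 * pi))^-1 * expR (- 2^-1).

Lemma horseshoe_lb_const_gt0 : 0 < horseshoe_lb_const.
Proof.
rewrite /horseshoe_lb_const mulr_gt0 ?expR_gt0// mulr_gt0// invr_gt0.
  by rewrite mulr_gt0 ?pi_gt0.
exact: lt_le_trans sqrt2pi_ge1.
Qed.

(** Keep only the scales between [s] and [2 s], where s^2 = 1 + (t / b)^2:
    there the half-Cauchy density is of order s^-2 and [t] is within one
    standard deviation. *)
Lemma horseshoe_pdf_lb t :
  ((horseshoe_lb_const * (b / (b ^+ 2 + t ^+ 2)))%:E <=
   horseshoe_pdf sigma tau t)%E.
Proof.
pose s := Num.sqrt (1 + t ^+ 2 / b ^+ 2).
have b2 : 0 < b ^+ 2 by rewrite exprn_gt0.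
have tb0 : 0 <= t ^+ 2 / b ^+ 2 by rewrite divr_ge0 ?sqr_ge0// ltW.
have sE : s ^+ 2 = 1 + t ^+ 2 / b ^+ 2 by rewrite sqr_sqrtr ?addr_ge0.
have bsE : (b * s) ^+ 2 = b ^+ 2 + t ^+ 2.
  by rewrite exprMn sE mulrDr mulr1 mulrCA divff ?mulr1// gt_eqF.
have s0 : 0 < s by rewrite sqrtr_gt0 ltr_wpDr.
have s2 : 0 < s ^+ 2 by rewrite exprn_gt0.
have s2ge1 : 1 <= s ^+ 2 by rewrite sE lerDl.
have rt0 : 0 < (Num.sqrt (2 * pi))^-1 :> R.
  by rewrite invr_gt0 (lt_le_trans _ sqrt2pi_ge1).
pose k := 2 / (pi * (5 * s ^+ 2)) *
  ((Num.sqrt (2 * pi))^-1 * (b * (2 * s))^-1 * expR (- 2^-1)).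
have k0 : 0 <= k.
  by rewrite /k; positivity.
have -> : horseshoe_lb_const * (b / (b ^+ 2 + t ^+ 2)) = k * s.
  have pi0 := @pi_gt0 R.
  have := lt0r_neq0 rt0; rewrite invr_eq0 -bsE /k /horseshoe_lb_const.
  move: (@pi R) pi0 (expR _) (Num.sqrt (2 * pi)) => p p0 e q q0; field.
  by rewrite q0 !gt_eqF.
have -> : (k * s)%:E = (\int[mu]_l (k * \1_`[s, 2 * s] l)%:E)%E.
  under eq_integral do rewrite EFinM.
  rewrite ge0_integralZl//; last first.
    by apply/measurable_EFinP; exact: measurable_indic.
  rewrite integral_indic//= setIT lebesgue_measure_itv/= lte_fin.
  by rewrite ltr_pMl// ltr1n -EFinB -EFinM; congr EFin; ring.
apply: ge0_le_integralT => l; first by rewrite lee_fin mulr_ge0.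
rewrite lee_fin indicE; case: (boolP (l \in _)) => [|_]; last first.
  by rewrite mulr0 horseshoe_joint_pdf_ge0.
rewrite inE/= in_itv/= mulr1 => /andP[sl l2s].
have l0 : 0 < l by exact: lt_le_trans sl.
rewrite /horseshoe_joint_pdf -/b half_cauchy_pdf_gt0E//.
have l2 : l ^+ 2 <= (2 * s) ^+ 2 by rewrite ler_sqr ?nnegrE ?mulr_ge0// ltW.
have bl0 : 0 < b * l by rewrite mulr_gt0.
apply: ler_pM.
- by positivity.
- by positivity.
- rewrite ler_pM2l// lef_pV2 ?posrE ?mulr_gt0 ?pi_gt0 ?addr_gt0 ?exprn_gt0//.
  rewrite ler_pM2l ?pi_gt0//; move: l2; rewrite exprMn; nra.
apply: ler_pM.
- by positivity.
- exact: expR_ge0.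
- rewrite ler_pM2l// lef_pV2 ?posrE ?mulr_gt0//.
  by rewrite ler_pM2l.
- rewrite ler_expR mulNr lerN2 ler_pdivrMr ?mulr_gt0 ?exprn_gt0//.
  rewrite mulrA mulVf// mul1r.
  have : (b * s) ^+ 2 <= (b * l) ^+ 2.
    by rewrite ler_sqr ?nnegrE ?ler_pM2l// ltW ?mulr_gt0.
  rewrite bsE; lra.
Qed.

Lemma horseshoe_integral_ub (g : R -> R) :
  (forall t, 0 <= g t) -> measurable_fun setT g ->
  (\int[horseshoe_prob sigma tau]_t (t ^+ 2 * g t)%:E <=
   (6 * b)%:E * \int[mu]_t (g t)%:E)%E.
Proof.
move=> g0 mg.
have tg0 t : (0 <= (t ^+ 2 * g t)%:E)%E by rewrite lee_fin mulr_ge0 ?sqr_ge0.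
rewrite ge0_integral_horseshoe//; last first.
  by apply/measurable_EFinP; apply: measurable_funM => //; exact: measurable_funX.
rewrite -ge0_integralZl//; last 3 first.
- exact/measurable_EFinP.
- by move=> t _; rewrite lee_fin.
- by rewrite lee_fin mulr_ge0// ltW.
apply: ge0_le_integralT => t; first by rewrite mule_ge0// horseshoe_pdf_ge0.
by rewrite mulrC EFinM -muleA [leRHS]muleC lee_wpmul2l ?lee_fin ?horseshoe_pdf_ub.
Qed.

(** The form in which the lower bound on the density is used: an interval of
    parameters on which the integrand is at least [m]. *)
Lemma horseshoe_integral_lb (g : R -> R) u v m S :
  (forall t, 0 <= g t) -> measurable_fun setT g -> u < v -> 0 <= m -> 0 <= S ->
  (forall t, u <= t <= v -> t ^+ 2 <= S /\ m <= g t) ->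
  ((horseshoe_lb_const * (b / (b ^+ 2 + S)) * m * (v - u))%:E <=
   \int[horseshoe_prob sigma tau]_t (g t)%:E)%E.
Proof.
move=> g0 mg uv m0 S0 gS.
rewrite ge0_integral_horseshoe//; last exact/measurable_EFinP.
set k := horseshoe_lb_const * _ * m.
have b2 : 0 < b ^+ 2 by rewrite exprn_gt0.
have c0 : 0 <= horseshoe_lb_const * (b / (b ^+ 2 + S)).
  by have h0 := horseshoe_lb_const_gt0; positivity.
have k0 : 0 <= k by rewrite /k mulr_ge0.
have -> : (k * (v - u))%:E = (\int[mu]_t (k * \1_`[u, v] t)%:E)%E.
  under eq_integral do rewrite EFinM.
  rewrite ge0_integralZl//; last first.
    by apply/measurable_EFinP; exact: measurable_indic.
  by rewrite integral_indic//= setIT lebesgue_measure_itv/= lte_fin uv.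
apply: ge0_le_integralT => t; first by rewrite lee_fin mulr_ge0.
rewrite indicE; case: (boolP (t \in _)) => [|_]; last first.
  by rewrite mulr0 mule_ge0 ?lee_fin ?horseshoe_pdf_ge0.
rewrite inE/= in_itv/= mulr1 => /gS[tS mgt].
rewrite /k EFinM muleC; apply: lee_pmul; rewrite ?lee_fin//.
apply: le_trans (horseshoe_pdf_lb t); rewrite lee_fin.
rewrite ler_pM2l ?horseshoe_lb_const_gt0// ler_pM2l// lef_pV2 ?posrE.
- by rewrite lerD2l.
- by rewrite ltr_wpDr.
- by rewrite ltr_wpDr ?sqr_ge0.
Qed.

End horseshoe_density_bounds.

(** * Marginal likelihood and posterior moments in one dimension *)

Section posterior_one_dim.
Context (R : realType).
Notation mu := (@lebesgue_measure R).
Variable sigma : R.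
Hypothesis sigma_gt0 : 0 < sigma.

Let sigma2_gt0 : 0 < sigma ^+ 2. Proof. exact: exprn_gt0. Qed.

(** Marginal density of one observation, up to the constant sqrt (2 pi)
    sigma. *)
Definition marginal_lik (tau y : R) : \bar R :=
  (\int[horseshoe_prob sigma tau]_t (gauss (2 * sigma ^+ 2) (y - t))%:E)%E.

Lemma measurable_gauss_shift (c y : R) :
  measurable_fun setT (fun t : R => gauss c (y - t)).
Proof.
apply: (measurableT_comp (@measurable_gauss R c)).
exact: measurable_funB.
Qed.

Lemma gauss_le (c u v : R) : 0 < c -> u ^+ 2 <= v ^+ 2 -> gauss c v <= gauss c u.
Proof. by move=> c0 uv; rewrite ler_expR ler_pM2r ?invr_gt0// lerN2. Qed.

Lemma integral_gaussB (c m : R) : 0 < c ->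
  (\int[mu]_x (gauss c (m - x))%:E = (Num.sqrt (c * pi))%:E)%E.
Proof.
move=> c0; rewrite -(integral_gauss m c0); apply: eq_integral => x _.
by rewrite /gauss -sqrrN opprB.
Qed.

(** Only the parameters between [y] and [y + 1] are used; the prior density
    there is of order tau / (1 + y^2). *)
Lemma marginal_lik_lb_poly : exists2 c : R, 0 < c &
  forall tau y, 0 < tau <= 1 ->
    ((c * tau / (1 + y ^+ 2))%:E <= marginal_lik tau y)%E.
Proof.
pose m := gauss (2 * sigma ^+ 2) 1.
have m0 : 0 < m by exact: expR_gt0.
have h0 := @horseshoe_lb_const_gt0 R.
exists (horseshoe_lb_const R * sigma * m / (sigma ^+ 2 + 2)); first by positivity.
move=> tau y /andP[t0 t1].
pose S : R := 2 * y ^+ 2 + 2.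
have y2 := sqr_ge0 y.
have S0 : 0 < S by rewrite /S ltr_wpDl// mulr_ge0.
apply: le_trans (@horseshoe_integral_lb _ sigma tau _ _ _ y (y + 1) m S
  _ _ _ _ _ _) => //.
- rewrite lee_fin addrAC subrr add0r mulr1.
  have y1 : 0 < 1 + y ^+ 2 by rewrite ltr_wpDr.
  set b := sigma * tau.
  have b0 : 0 < b by exact: mulr_gt0.
  have bs : b ^+ 2 <= sigma ^+ 2.
    by rewrite ler_sqr ?nnegrE ?ler_piMr// ltW.
  rewrite [leLHS](_ : _ = horseshoe_lb_const R *
      (b / ((sigma ^+ 2 + 2) * (1 + y ^+ 2))) * m); last first.
    have s2 : 0 < sigma ^+ 2 + 2 by rewrite addr_gt0.
    by rewrite /b; field; rewrite !gt_eqF.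
  rewrite ler_pM2r// ler_pM2l// ler_pM2l// lef_pV2 ?posrE.
  + rewrite /S; nra.
  + by positivity.
  + by positivity.
- by move=> t; exact: gauss_ge0.
- exact: measurable_gauss_shift.
- by rewrite ltrDl.
- exact: ltW.
- exact: ltW.
- move=> t /andP[yt ty].
  have d1 : (t - y) ^+ 2 <= 1 by nra.
  split; first by rewrite /S; have := sqr_ge0 (2 * y - t); nra.
  apply: gauss_le; first by rewrite mulr_gt0.
  by rewrite -sqrrN opprB expr1n.
Qed.

(** Only the parameters of the sign of [y] and of size at most b = sigma tau
    are used: they carry a fixed fraction of the prior mass, and for them the
    exponential of the cross term y t is at least 1. *)
Lemma marginal_lik_lb_gauss : exists2 c : R, 0 < c &
  forall tau y, 0 < tau <= 1 ->
    ((c * gauss (2 * sigma ^+ 2) y)%:E <= marginal_lik tau y)%E.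
Proof.
pose e := gauss (2 * sigma ^+ 2) sigma.
have e0 : 0 < e by exact: expR_gt0.
have h0 := @horseshoe_lb_const_gt0 R.
exists (horseshoe_lb_const R * e / 2); first by positivity.
move=> tau y /andP[t0 t1].
set b := sigma * tau.
have b0 : 0 < b by exact: mulr_gt0.
have b2 : 0 < b ^+ 2 by exact: exprn_gt0.
have bs : b ^+ 2 <= sigma ^+ 2.
  by rewrite ler_sqr ?nnegrE ?ler_piMr// ltW.
pose m := e * gauss (2 * sigma ^+ 2) y.
have m0 : 0 <= m by rewrite mulr_ge0 ?gauss_ge0// ltW.
have mE (u v : R) : v - u = b ->
    (horseshoe_lb_const R * e / 2 * gauss (2 * sigma ^+ 2) y)%:E =
    (horseshoe_lb_const R * (b / (b ^+ 2 + b ^+ 2)) * m * (v - u))%:E.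
  move=> ->; congr EFin; rewrite /m; field.
  by rewrite -mulr2n mulrn_eq0/= !gt_eqF.
have mub t : t ^+ 2 <= b ^+ 2 -> 0 <= y * t -> m <= gauss (2 * sigma ^+ 2) (y - t).
  move=> tb yt; rewrite /m /e /gauss -expRD ler_expR -mulrDl.
  rewrite ler_pM2r ?invr_gt0 ?mulr_gt0//; nra.
have [y0|y0] := leP 0 y.
- rewrite (mE 0 b (subr0 b)).
  apply: horseshoe_integral_lb => //.
  + by move=> t; exact: gauss_ge0.
  + exact: measurable_gauss_shift.
  + exact: ltW.
  + move=> t /andP[t0' tb].
    have tb2 : t ^+ 2 <= b ^+ 2 by rewrite ler_sqr ?nnegrE// ltW.
    by split => //; apply: mub => //; exact: mulr_ge0.
- rewrite (mE (- b) 0 (etrans (sub0r _) (opprK b))).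
  apply: horseshoe_integral_lb => //.
  + by move=> t; exact: gauss_ge0.
  + exact: measurable_gauss_shift.
  + by rewrite oppr_lt0.
  + exact: ltW.
  + move=> t /andP[t0' tb].
    have tb2 : t ^+ 2 <= b ^+ 2.
      by rewrite -sqrrN ler_sqr ?nnegrE ?oppr_ge0 ?(ltW b0)// lerNl.
    by split => //; apply: mub => //; rewrite mulr_le0// ltW.
Qed.

Lemma integral_cst_horseshoe tau (k : R) :
  (\int[horseshoe_prob sigma tau]__ k%:E = k%:E)%E.
Proof.
rewrite integral_cst// (_ : (_ [set: _] = 1)%E) ?mule1//.
exact: probability_setT.
Qed.

Lemma horseshoe_integralZl tau (a : R) (g : R -> R) :
  0 <= a -> (forall t, 0 <= g t) -> measurable_fun setT g ->
  (\int[horseshoe_prob sigma tau]_t (a%:E * (g t)%:E) =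
   a%:E * \int[horseshoe_prob sigma tau]_t (g t)%:E)%E.
Proof.
move=> a0 g0 mg; rewrite ge0_integralZl//; first exact/measurable_EFinP.
by move=> t _; rewrite lee_fin.
Qed.

Lemma marginal_lik_fin tau y : marginal_lik tau y \is a fin_num.
Proof.
rewrite ge0_fin_numE; last by apply: integral_ge0 => t _; rewrite lee_fin gauss_ge0.
apply: (@le_lt_trans _ _ (\int[horseshoe_prob sigma tau]__ 1)%E); last first.
  by rewrite integral_cst_horseshoe ltry.
apply: ge0_le_integralT => t; rewrite lee_fin ?gauss_ge0//.
rewrite /gauss -expR0 ler_expR mulNr oppr_le0; positivity.
Qed.


Let mul_expRN_le1 (x : R) : x * expR (- x) <= 1.
Proof.
rewrite expRN ler_pdivrMr ?expR_gt0// mul1r.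
by apply: le_trans (expR_ge1Dx x); rewrite lerDr.
Qed.

(** The tempered marginal density, with noise variance 2 sigma^2. Bound 1 + y^2
    by 1 + 2 (y - t)^2 + 2 t^2: the Gaussian factor absorbs (y - t)^2, and t^2
    is paid for by the tail b / t^2 of the prior. *)
Lemma flat_lik_ub : exists2 k : R, 0 < k &
  forall tau y, 0 < tau <= 1 ->
    (\int[horseshoe_prob sigma tau]_t (gauss (4 * sigma ^+ 2) (y - t))%:E <=
     (k / (1 + y ^+ 2))%:E)%E.
Proof.
pose c := 4 * sigma ^+ 2.
have c0 : 0 < c by positivity.
pose q := Num.sqrt (c * pi).
have q0 : 0 < q by rewrite sqrtr_gt0; positivity.
exists (1 + 2 * c + 12 * sigma * q); first by positivity.
move=> tau y /andP[t0 t1].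
pose g t := gauss c (y - t).
have g0 t : 0 <= g t by exact: gauss_ge0.
have mg : measurable_fun setT g by exact: measurable_gauss_shift.
have g1 t : g t <= 1.
  by rewrite /g /gauss -expR0 ler_expR mulNr oppr_le0; positivity.
have y1 : 0 < 1 + y ^+ 2 by rewrite ltr_wpDr ?sqr_ge0.
have pt t : (1 + y ^+ 2) * g t <= (1 + 2 * c) + 2 * (t ^+ 2 * g t).
  have dg : (y - t) ^+ 2 * g t <= c.
    have := mul_expRN_le1 ((y - t) ^+ 2 / c).
    rewrite -[X in _ -> _ <= X]mul1r -ler_pdivrMr// /g /gauss mulNr.
    by rewrite [X in _ -> X <= _]mulrAC.
  have : y ^+ 2 * g t <= (2 * (y - t) ^+ 2 + 2 * t ^+ 2) * g t.
    by apply: ler_wpM2r => //; have := sqr_ge0 (y - 2 * t); nra.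
  have := g1 t; nra.
have mt2g : measurable_fun setT (fun t : R => t ^+ 2 * g t).
  by apply: measurable_funM => //; exact: measurable_funX.
have key : ((1 + y ^+ 2)%:E * (\int[horseshoe_prob sigma tau]_t (g t)%:E) <=
    (1 + 2 * c + 12 * sigma * q)%:E)%E.
  rewrite -ge0_integralZl//; last 3 first.
  - exact/measurable_EFinP.
  - by move=> t _; rewrite lee_fin.
  - by rewrite lee_fin ltW.
  apply: (@le_trans _ _ (\int[horseshoe_prob sigma tau]_t
      ((1 + 2 * c)%:E + 2%:E * (t ^+ 2 * g t)%:E))%E).
    apply: ge0_le_integralT => t; rewrite -?EFinM lee_fin.
      by rewrite mulr_ge0 ?(ltW y1).
    exact: pt.
  have h0 t : (0 <= (t ^+ 2 * g t)%:E)%E by rewrite lee_fin mulr_ge0 ?sqr_ge0.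
  rewrite ge0_integralD//; last 3 first.
  - by move=> t _; rewrite lee_fin; positivity.
  - by move=> t _; rewrite mule_ge0.
  - by apply: measurable_funeM; exact/measurable_EFinP.
  rewrite integral_cst_horseshoe [leRHS]EFinD leeD2l//.
  rewrite ge0_integralZl//; last exact/measurable_EFinP.
  have := horseshoe_integral_ub sigma_gt0 t0 g0 mg.
  rewrite (integral_gaussB y c0) -/q => ub.
  apply: (le_trans (lee_wpmul2l _ ub)); first by rewrite lee_fin.
  rewrite -!EFinM lee_fin !mulrA.
  rewrite ler_wpM2r ?(ltW q0)// (_ : 2 * 6 = 12 :> R); last by ring.
  by rewrite ler_piMr//; positivity.
by rewrite EFinM lee_pdivlMr// muleC.
Qed.

End posterior_one_dim.

Section posterior_moments.
Context (R : realType).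
Notation mu := (@lebesgue_measure R).
Variable sigma : R.
Hypothesis sigma_gt0 : 0 < sigma.

Lemma lnV_ge_ln2 (tau : R) : 0 < tau <= 2^-1 -> ln 2 <= ln tau^-1.
Proof.
move=> /andP[t0 t2]; rewrite ler_ln ?posrE ?invr_gt0//.
by rewrite -[leLHS]invrK lef_pV2 ?posrE ?invr_gt0.
Qed.

Lemma ln2_gt0 : 0 < ln 2 :> R. Proof. by rewrite ln_gt0// ltr1n. Qed.

(** A posterior second moment around the observation is of order ln (1 / tau),
    for every observation: use x <= ln A + e^x / A with x =
    (y - t)^2 / (4 sigma^2). The factor e^x turns the Gaussian weight into the
    tempered one of [flat_lik_ub], which A = K / tau makes smaller than A times
    the marginal density. *)
Lemma posterior_moment_obs : exists2 C : R, 0 < C &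
  forall tau y, 0 < tau <= 2^-1 ->
    (\int[horseshoe_prob sigma tau]_t
       ((y - t) ^+ 2 * gauss (2 * sigma ^+ 2) (y - t))%:E <=
     (C * ln tau^-1)%:E * marginal_lik sigma tau y)%E.
Proof.
have [c c0 cP] := marginal_lik_lb_poly sigma_gt0.
have [k k0 kP] := flat_lik_ub sigma_gt0.
have l2 := ln2_gt0.
have s2 : 0 < 4 * sigma ^+ 2 by positivity.
pose K := Num.max 1 (k / c).
have K1 : 1 <= K by rewrite le_max lexx.
have K0 : 0 < K by exact: lt_le_trans K1.
have lK : 0 <= ln K by rewrite ln_ge0.
exists (4 * sigma ^+ 2 * ((ln K + 1) / ln 2 + 1)).
  by rewrite mulr_gt0// ltr_wpDl// divr_ge0 ?addr_ge0// ltW.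
move=> tau y t12; have /andP[t0 t2] := t12.
have t1 : 0 < tau <= 1 by rewrite t0/= (le_trans t2)// invf_le1// ler1n.
have lt2 := lnV_ge_ln2 t12.
pose A := K / tau.
have A0 : 0 < A by rewrite divr_gt0.
have lA : ln A = ln K + ln tau^-1 by rewrite lnM ?posrE ?invr_gt0.
have lA0 : 0 <= ln A by rewrite lA addr_ge0// (le_trans _ lt2)// ltW.
pose g2 t := gauss (2 * sigma ^+ 2) (y - t).
pose g4 t := gauss (4 * sigma ^+ 2) (y - t).
have mg2 : measurable_fun setT g2 by exact: measurable_gauss_shift.
have mg4 : measurable_fun setT g4 by exact: measurable_gauss_shift.
have pt t : (y - t) ^+ 2 * g2 t <=
    4 * sigma ^+ 2 * (ln A * g2 t + A^-1 * g4 t).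
  set u := (y - t) ^+ 2 / (4 * sigma ^+ 2).
  have -> : (y - t) ^+ 2 = 4 * sigma ^+ 2 * u.
    by rewrite mulrCA divff ?mulr1// gt_eqF.
  rewrite -(mulrA (4 * sigma ^+ 2) u) (ler_pM2l s2).
  have g4E : g4 t = expR u * g2 t.
    rewrite /g4 /g2 /gauss -expRD /u; congr expR; field.
    by rewrite gt_eqF.
  rewrite g4E mulrA -mulrDl ler_wpM2r ?gauss_ge0//.
  have := expR_ge1Dx (u - ln A).
  rewrite expRD expRN lnK ?posrE// mulrC; lra.
have D0 : (0 <= marginal_lik sigma tau y)%E.
  by apply: integral_ge0 => t _; rewrite lee_fin gauss_ge0.
apply: (@le_trans _ _ (\int[horseshoe_prob sigma tau]_t
    ((4 * sigma ^+ 2)%:E * ((ln A)%:E * (g2 t)%:E + (A^-1)%:E * (g4 t)%:E)))%E).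
  apply: ge0_le_integralT => t; last by have := pt t; rewrite -lee_fin.
  by rewrite lee_fin mulr_ge0 ?sqr_ge0 ?gauss_ge0.
have h2 t : (0 <= (ln A)%:E * (g2 t)%:E)%E.
  by rewrite mule_ge0 ?lee_fin ?gauss_ge0.
have h4 t : (0 <= (A^-1)%:E * (g4 t)%:E)%E.
  by rewrite mule_ge0 ?lee_fin ?gauss_ge0// invr_ge0 ltW.
have mh2 : measurable_fun setT (fun t => (ln A)%:E * (g2 t)%:E)%E.
  by apply: measurable_funeM; exact/measurable_EFinP.
have mh4 : measurable_fun setT (fun t => (A^-1)%:E * (g4 t)%:E)%E.
  by apply: measurable_funeM; exact/measurable_EFinP.
rewrite ge0_integralZl//; last 3 first.
- exact: emeasurable_funD.
- by move=> t _; rewrite adde_ge0.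
- by rewrite lee_fin ltW.
rewrite ge0_integralD//.
have g20 t : 0 <= g2 t by exact: gauss_ge0.
have g40 t : 0 <= g4 t by exact: gauss_ge0.
rewrite (horseshoe_integralZl _ _ lA0 g20 mg2).
have Ai0 : 0 <= A^-1 by rewrite invr_ge0 ltW.
rewrite (horseshoe_integralZl _ _ Ai0 g40 mg4).
rewrite -/(marginal_lik sigma tau y).
rewrite [X in (_ <= X * _)%E](_ : _ = (4 * sigma ^+ 2)%:E *
  (((ln K + 1) / ln 2 + 1) * ln tau^-1)%:E)%E; last first.
  by rewrite -EFinM (mulrA (4 * sigma ^+ 2)).
rewrite -[leRHS]muleA lee_wpmul2l ?lee_fin ?(ltW s2)//.
have NA : ((A^-1)%:E * \int[horseshoe_prob sigma tau]_t (g4 t)%:E <=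
    marginal_lik sigma tau y)%E.
  apply: (@le_trans _ _ ((A^-1)%:E * (k / (1 + y ^+ 2))%:E)%E).
    by rewrite lee_wpmul2l ?lee_fin ?invr_ge0 ?(ltW A0)// kP.
  apply: le_trans (cP _ _ t1); rewrite -EFinM lee_fin.
  have y1 : 0 < 1 + y ^+ 2 by rewrite ltr_wpDr ?sqr_ge0.
  rewrite mulrA ler_pM2r ?invr_gt0// /A invf_div mulrAC ler_pdivrMr//.
  have : k / c <= K by rewrite le_max lexx orbT.
  rewrite ler_pdivrMr// => kc.
  by rewrite (_ : c * tau * K = tau * (K * c)) ?ler_pM2l//; ring.
apply: (@le_trans _ _
  ((ln A)%:E * marginal_lik sigma tau y + marginal_lik sigma tau y)%E).
  by rewrite leeD2l.
rewrite -[X in (_ + X <= _)%E]mul1e -ge0_muleDl ?lee_fin//.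
rewrite lee_wpmul2r// -EFinD lee_fin lA mulrDl mul1r addrAC lerD2r.
by rewrite mulrAC -mulrA ler_pMr ?ler_pdivlMr ?mul1r// ltr_wpDl.
Qed.

(** The factor t^2 cancels the tail b / t^2 of the prior, and the Gaussian
    factor is then integrated against the Lebesgue measure. *)
Lemma lik_moment0 tau y : 0 < tau ->
  (\int[horseshoe_prob sigma tau]_t
     (t ^+ 2 * gauss (2 * sigma ^+ 2) (y - t))%:E <=
   (6 * sigma * Num.sqrt (2 * sigma ^+ 2 * pi) * tau)%:E)%E.
Proof.
move=> t0.
have := @horseshoe_integral_ub _ _ _ sigma_gt0 t0
  (fun t => gauss (2 * sigma ^+ 2) (y - t))
  (fun t => gauss_ge0 _ _) (measurable_gauss_shift _ _).
rewrite integral_gaussB; last by positivity.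
move=> /le_trans; apply; rewrite -EFinM lee_fin le_eqVlt; apply/orP; left.
by apply/eqP; ring.
Qed.

End posterior_moments.

Section coordinate_risk.
Context (R : realType).
Notation mu := (@lebesgue_measure R).
Variable sigma : R.
Hypothesis sigma_gt0 : 0 < sigma.

Let s2_gt0 : 0 < sigma ^+ 2. Proof. exact: exprn_gt0. Qed.

(** The rate 3/8 is below 1/2, so that the weight is integrable under
    N(t, sigma^2), and above 1/4 by a margin of 1/8: the part 1/4 is spent on
    the Chernoff bound beyond [zeta], the part 1/8 dominates u^2. *)
Definition growth (u : R) : R := expR (3 * u ^+ 2 / (8 * sigma ^+ 2)).

Lemma measurable_growth (t : R) : measurable_fun setT (fun y : R => growth (y - t)).
Proof.
rewrite /growth; apply: measurableT_comp => //; apply: measurable_funM => //.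
by apply: measurable_funM => //; apply: measurable_funX; exact: measurable_funB.
Qed.

Lemma normal_integral_growth (t : R) :
  (\int[normal_prob t sigma]_y (growth (y - t))%:E = 2%:E)%E.
Proof.
rewrite ge0_integral_normal_prob; last 2 first.
- by move=> y; rewrite lee_fin expR_ge0.
- by apply/measurable_EFinP; exact: measurable_growth.
pose q := Num.sqrt (sigma ^+ 2 * 2 * pi).
have q0 : 0 < q by rewrite sqrtr_gt0; positivity.
transitivity (\int[mu]_y ((q^-1)%:E * (gauss (8 * sigma ^+ 2) (y - t))%:E))%E.
  apply: eq_integral => y _.
  rewrite normal_pdf_gauss// -!EFinM -/q -(mulrA q^-1); congr (_ * _)%:E.
  rewrite /growth /gauss -expRD; congr expR; field.
  by rewrite gt_eqF.
rewrite ge0_integralZl//; last 3 first.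
- apply/measurable_EFinP; apply: (measurableT_comp (@measurable_gauss R _)).
  exact: measurable_funB.
- by move=> y _; rewrite lee_fin gauss_ge0.
- by rewrite lee_fin invr_ge0 ltW.
rewrite integral_gauss; last by positivity.
rewrite (_ : 8 * _ * _ = 2 ^+ 2 * (sigma ^+ 2 * 2 * pi)); last by ring.
rewrite sqrtrM ?sqr_ge0// sqrtr_sqr ger0_norm// -EFinM -/q.
by congr EFin; rewrite mulrCA mulVf ?mulr1// gt_eqF.
Qed.

Lemma sqr_le_growth (u k : R) : 0 <= k ->
  k + 2 * u ^+ 2 <= (k + 16 * sigma ^+ 2) * expR (u ^+ 2 / (8 * sigma ^+ 2)).
Proof.
move=> k0; set v := u ^+ 2 / (8 * sigma ^+ 2).
have -> : u ^+ 2 = 8 * sigma ^+ 2 * v.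
  by rewrite /v mulrCA divff ?mulr1// gt_eqF//; positivity.
have v0 : 0 <= v by rewrite /v divr_ge0 ?sqr_ge0//; positivity.
apply: (@le_trans _ _ ((k + 16 * sigma ^+ 2) * (1 + v))).
  by have := mulr_ge0 k0 v0; nra.
rewrite ler_wpM2l ?expR_ge1Dx//; positivity.
Qed.

Lemma growth_ge (u : R) : expR (u ^+ 2 / (8 * sigma ^+ 2)) <= growth u.
Proof.
rewrite ler_expR; apply: ler_wpM2r; first by rewrite invr_ge0; positivity.
by have := sqr_ge0 u; lra.
Qed.

(** (x - t)^2 <= 2 (y - x)^2 + 2 (y - t)^2. *)
Lemma lik_moment_split tau t y : 0 < tau ->
  (\int[horseshoe_prob sigma tau]_x
     ((x - t) ^+ 2 * gauss (2 * sigma ^+ 2) (y - x))%:E <=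
   2%:E * \int[horseshoe_prob sigma tau]_x
     ((y - x) ^+ 2 * gauss (2 * sigma ^+ 2) (y - x))%:E +
   (2 * (y - t) ^+ 2)%:E * marginal_lik sigma tau y)%E.
Proof.
move=> tau0; pose g x := gauss (2 * sigma ^+ 2) (y - x).
have g0 x : 0 <= g x by exact: gauss_ge0.
have mg : measurable_fun setT g by exact: measurable_gauss_shift.
have mg2 : measurable_fun setT (fun x : R => (y - x) ^+ 2 * g x).
  by apply: measurable_funM => //; apply: measurable_funX; exact: measurable_funB.
have yg0 x : 0 <= (y - x) ^+ 2 * g x by rewrite mulr_ge0 ?sqr_ge0.
have yt0 : 0 <= 2 * (y - t) ^+ 2 by rewrite mulr_ge0 ?sqr_ge0.
rewrite /marginal_lik -(horseshoe_integralZl _ _ (ler0n _ 2) yg0 mg2).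
rewrite -(horseshoe_integralZl _ _ yt0 g0 mg).
rewrite -ge0_integralD//; last 4 first.
- by move=> x _; rewrite mule_ge0 ?lee_fin.
- by apply: measurable_funeM; exact/measurable_EFinP.
- by move=> x _; rewrite mule_ge0 ?lee_fin.
- by apply: measurable_funeM; exact/measurable_EFinP.
apply: ge0_le_integralT => x.
  by rewrite lee_fin mulr_ge0 ?sqr_ge0 ?gauss_ge0.
have : (x - t) ^+ 2 * g x <= 2 * ((y - x) ^+ 2 * g x) + 2 * (y - t) ^+ 2 * g x.
  rewrite mulrA -mulrDl ler_wpM2r//.
  have := sqr_ge0 (2 * y - x - t); nra.
by rewrite -lee_fin.
Qed.

(** [U t y] bounds the posterior second moment around [t] given [y]. It is
    explicit and measurable, and the last two bounds are its risks under the
    truth [t] and under the truth 0. *)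
Lemma posterior_coordinate_risk : exists2 C : R, 0 < C &
  forall tau, 0 < tau <= 2^-1 -> exists U : R -> R -> R,
  [/\ forall t y, 0 <= U t y,
      forall t, measurable_fun setT (U t),
      forall t y, (\int[horseshoe_prob sigma tau]_x
         ((x - t) ^+ 2 * gauss (2 * sigma ^+ 2) (y - x))%:E <=
         (U t y)%:E * marginal_lik sigma tau y)%E,
      forall t, (\int[normal_prob t sigma]_y (U t y)%:E <= (C * ln tau^-1)%:E)%E
    & (\int[normal_prob 0 sigma]_y (U 0 y)%:E <= (C * tau * ln tau^-1)%:E)%E].
Proof.
have [C C0 CP] := posterior_moment_obs sigma_gt0.
have [c c0 cP] := marginal_lik_lb_gauss sigma_gt0.
have l2 := ln2_gt0 R.
pose q := Num.sqrt (sigma ^+ 2 * 2 * pi).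
have q0 : 0 < q by rewrite sqrtr_gt0; positivity.
pose a := 6 * sigma * Num.sqrt (2 * sigma ^+ 2 * pi) / c.
have a0 : 0 < a.
  by rewrite /a divr_gt0// !mulr_gt0// sqrtr_gt0; positivity.
(* The constant terms are absorbed using 1 <= L / ln 2. *)
pose C1 := 2 * (2 * C + 16 * sigma ^+ 2 / ln 2).
have C10 : 0 < C1.
  by rewrite /C1; positivity.
pose C2 := a / q * (2 * (2 * sigma * (1 + (ln 2)^-1))).
have C20 : 0 < C2 by rewrite /C2; positivity.
exists (C1 + C2); first exact: addr_gt0.
move=> tau t12; have /andP[t0 t2] := t12.
have t1 : 0 < tau <= 1 by rewrite t0/= (le_trans t2)// invf_le1// ler1n.
pose L := ln tau^-1.
have lt2 : ln 2 <= L := lnV_ge_ln2 t12.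
have L0 : 0 < L by exact: lt_le_trans lt2.
have L1 : 1 <= L / ln 2 by rewrite ler_pdivlMr// mul1r.
pose w := 2 * C * L + 16 * sigma ^+ 2.
have w0 : 0 < w by rewrite /w; positivity.
have wC1 : w * 2 <= C1 * L.
  have : 16 * sigma ^+ 2 <= 16 * sigma ^+ 2 / ln 2 * L.
    rewrite -mulrA (mulrC _^-1) ler_pMr//; positivity.
  by rewrite /w /C1; lra.
(* With this cutoff, exp (zeta^2 / (4 sigma^2)) = 1 / tau. *)
pose zeta := 2 * sigma * Num.sqrt L.
have zeta0 : 0 < zeta by rewrite /zeta !mulr_gt0// sqrtr_gt0.
have zeta2 : zeta ^+ 2 = 4 * sigma ^+ 2 * L.
  by rewrite /zeta !exprMn sqr_sqrtr ?(ltW L0)//; ring.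
(* [V] is the bound for an arbitrary true value. *)
pose V t y := w * growth (y - t).
have V0 t y : 0 <= V t y by rewrite mulr_ge0 ?expR_ge0// ltW.
have mV t : measurable_fun setT (V t).
  by apply: measurable_funM => //; exact: measurable_growth.
(* [Z] is the bound for the true value 0 and an observation in the cutoff. *)
pose Z y := a * tau * (\1_`[- zeta, zeta] y / gauss (2 * sigma ^+ 2) y).
have Z0 y : 0 <= Z y.
  by rewrite mulr_ge0 ?divr_ge0 ?gauss_ge0// ltW// mulr_gt0.
have mZ : measurable_fun setT Z.
  apply: measurable_funM => //; apply: measurable_funM.
    exact: measurable_indic.
  exact: (measurableT_comp (@measurable_invr R) (@measurable_gauss R _)).
have D0 y : (0 <= marginal_lik sigma tau y)%E.
  by apply: integral_ge0 => x _; rewrite lee_fin gauss_ge0.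
have crude t y : (\int[horseshoe_prob sigma tau]_x
    ((x - t) ^+ 2 * gauss (2 * sigma ^+ 2) (y - x))%:E <=
    (2 * C * L + 2 * (y - t) ^+ 2)%:E * marginal_lik sigma tau y)%E.
  apply: (le_trans (lik_moment_split t y t0)).
  have h1 : (0 <= (2 * C * L)%:E)%E by rewrite lee_fin ltW//; positivity.
  have h2 : (0 <= (2 * (y - t) ^+ 2)%:E)%E by rewrite lee_fin mulr_ge0 ?sqr_ge0.
  rewrite EFinD (ge0_muleDl _ h1 h2).
  rewrite leeD2r// -(mulrA 2) EFinM -muleA lee_wpmul2l ?lee_fin//.
  exact: CP.
have VP t y : (\int[horseshoe_prob sigma tau]_x
    ((x - t) ^+ 2 * gauss (2 * sigma ^+ 2) (y - x))%:E <=
    (V t y)%:E * marginal_lik sigma tau y)%E.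
  apply: (le_trans (crude t y)); rewrite lee_wpmul2r// lee_fin.
  apply: le_trans (sqr_le_growth _ _) _; first by rewrite ltW//; positivity.
  by rewrite ler_wpM2l ?growth_ge// ltW.
have iV t : (\int[normal_prob t sigma]_y (V t y)%:E = (w * 2)%:E)%E.
  under eq_integral do rewrite EFinM.
  rewrite ge0_integralZl//; last 3 first.
  - by apply/measurable_EFinP; exact: measurable_growth.
  - by move=> y _; rewrite lee_fin expR_ge0.
  - by rewrite lee_fin ltW.
  by rewrite normal_integral_growth.
have iZ : (\int[normal_prob 0 sigma]_y (Z y)%:E <= (C2 * tau * L)%:E)%E.
  rewrite ge0_integral_normal_prob; last 2 first.
  - by move=> y; rewrite lee_fin.
  - exact/measurable_EFinP.
  rewrite (_ : (\int[_]_y _)%E =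
    (\int[mu]_y ((a * tau / q)%:E * (\1_`[- zeta, zeta] y)%:E))%E); last first.
    apply: eq_integral => y _; rewrite normal_pdf_gauss// subr0 -/q -!EFinM.
    rewrite /Z; congr EFin; field.
    by rewrite !gt_eqF// expR_gt0.
  rewrite ge0_integralZl//; last 2 first.
  - by apply/measurable_EFinP; exact: measurable_indic.
  - by rewrite lee_fin ltW//; positivity.
  rewrite integral_indic//= setIT lebesgue_measure_itv/= lte_fin gt0_cp//.
  rewrite -EFinB opprK -EFinM lee_fin.
  have sL : Num.sqrt L <= L * (1 + (ln 2)^-1).
    rewrite -(@ler_sqr R) ?nnegrE ?sqrtr_ge0//; last by rewrite ltW//; positivity.
    rewrite sqr_sqrtr ?(ltW L0)//.
    have : 0 < (ln 2)^-1 :> R by rewrite invr_gt0.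
    move: L1; set e := (ln 2)^-1 => L1 e0.
    nra.
  rewrite [leLHS](_ : _ = a / q * (2 * (2 * sigma)) * tau * Num.sqrt L); last first.
    by rewrite /zeta; ring.
  rewrite [leRHS](_ : _ = a / q * (2 * (2 * sigma)) * tau * (L * (1 + (ln 2)^-1)));
    last by rewrite /C2; ring.
  by rewrite ler_wpM2l// ltW//; positivity.
have iU0 : (\int[normal_prob 0 sigma]_y (Z y + tau * V 0 y)%:E <=
    ((C1 + C2) * tau * L)%:E)%E.
  have h1 y : (0 <= (Z y)%:E)%E by rewrite lee_fin.
  have h2 y : (0 <= (V 0 y)%:E)%E by rewrite lee_fin.
  have h3 y : (0 <= tau%:E * (V 0 y)%:E)%E by rewrite mule_ge0// lee_fin ltW.
  have mZ' : measurable_fun setT (fun y : measurableTypeR R => (Z y)%:E).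
    exact/measurable_EFinP.
  have mV' : measurable_fun setT (fun y : measurableTypeR R => (V 0 y)%:E).
    by apply/measurable_EFinP; exact: (mV 0).
  have -> : (\int[normal_prob 0 sigma]_y (Z y + tau * V 0 y)%:E =
      \int[normal_prob 0 sigma]_y ((Z y)%:E + tau%:E * (V 0 y)%:E))%E.
    by apply: eq_integral.
  rewrite ge0_integralD//; last exact: (measurable_funeM _ mV').
  rewrite (ge0_integralZl (k := tau%:E) (normal_prob 0 sigma) measurableT mV')//;
    last first.
    by rewrite lee_fin ltW.
  rewrite iV; apply: (le_trans (leeD2r _ iZ)); rewrite -EFinM -EFinD lee_fin.
  have := ler_wpM2l (ltW t0) wC1; nra.
pose U t := if t == 0 then fun y => Z y + tau * V 0 y else V t.
exists U; split.
- by move=> t y; rewrite /U; case: ifPn => _//; rewrite addr_ge0// mulr_ge0// ltW.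
- move=> t; rewrite /U; case: ifPn => _ //.
  by apply: measurable_funD => //; exact: measurable_funM.
- move=> t y; rewrite /U; case: ifPn => [/eqP ->|_]; last exact: VP.
  have [yz|zy] := leP (y ^+ 2) (zeta ^+ 2).
    apply: (@le_trans _ _ ((Z y)%:E * marginal_lik sigma tau y)%E); last first.
      by rewrite lee_wpmul2r// lee_fin lerDl mulr_ge0// ltW.
    have yin : \1_`[- zeta, zeta] y = 1 :> R.
      rewrite indicE mem_set//= in_itv/= -ler_norml.
      by rewrite -(ler_sqr (normr_ge0 y) (ltW zeta0)) real_normK ?num_real.
    rewrite /Z yin mul1r.
    under eq_integral do rewrite subr0.
    apply: (le_trans (lik_moment0 sigma_gt0 y t0)).
    have g0 : 0 < gauss (2 * sigma ^+ 2) y by exact: expR_gt0.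
    apply: (@le_trans _ _ ((a * tau / gauss (2 * sigma ^+ 2) y)%:E *
        (c * gauss (2 * sigma ^+ 2) y)%:E)%E); last first.
      by rewrite lee_wpmul2l ?cP// lee_fin ltW//; positivity.
    rewrite -EFinM lee_fin /a le_eqVlt; apply/orP; left; apply/eqP.
    field; by rewrite !gt_eqF.
  apply: (le_trans (crude 0 y)); rewrite lee_wpmul2r// lee_fin.
  apply: (@le_trans _ _ (tau * V 0 y)); last by rewrite lerDr.
  rewrite subr0.
  apply: le_trans (sqr_le_growth _ _) _; first by rewrite ltW//; positivity.
  rewrite -/w /V subr0 (mulrCA tau) (ler_pM2l w0) /growth.
  rewrite (_ : 3 * y ^+ 2 / (8 * sigma ^+ 2) =
      y ^+ 2 / (8 * sigma ^+ 2) + y ^+ 2 / (4 * sigma ^+ 2)); last first.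
    by field; rewrite gt_eqF.
  rewrite expRD (mulrCA tau) ler_pMr ?expR_gt0//.
  rewrite -ler_pdivrMl// mulr1 -(@lnK _ tau^-1) ?posrE ?invr_gt0// ler_expR.
  by rewrite ler_pdivlMr ?mulr_gt0// mulrC -zeta2 ltW.
- move=> t; rewrite /U; case: ifPn => [/eqP ->|_]; last first.
    by rewrite iV lee_fin (le_trans wC1)// ler_wpM2r ?lerDl// ltW.
  apply: (le_trans iU0); rewrite lee_fin ler_wpM2r ?(ltW L0)// ler_piMr//.
    by rewrite ltW// addr_gt0.
  by case/andP: t1.
- by rewrite /U eqxx.
Qed.

End coordinate_risk.

(** * Bayes' formula for the vector of observations *)

Section mixture_measure.
Local Open Scope ereal_scope.
Context d1 d2 (T1 : measurableType d1) (T2 : measurableType d2) (R : realType).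
Variable mu : {measure set T1 -> \bar R}.
Variable k : T1 -> {measure set T2 -> \bar R}.
Hypothesis mk : forall U, measurable U -> measurable_fun setT (k ^~ U).

(** The measurability proof is an argument so that the measure structure on
    [mixture] can be inferred. *)
Definition mixture & (forall U, measurable U -> measurable_fun setT (k ^~ U))
    : set T2 -> \bar R :=
  fun A => \int[mu]_x k x A.

Let mixture0 : mixture mk set0 = 0.
Proof. by rewrite /mixture integral0_eq// => x _; rewrite measure0. Qed.

Let mixture_ge0 A : 0 <= mixture mk A.
Proof. by apply: integral_ge0. Qed.

Let mixture_sigma_additive : semi_sigma_additive (mixture mk).
Proof.
move=> F mF tF mUF; rewrite [X in _ --> X](_ : _ =
    \sum_(n <oo) mixture mk (F n)); last first.
  rewrite -integral_nneseries//; last by move=> n; exact: mk.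
  apply: eq_integral => x _; apply/esym/cvg_lim => //.
  exact: measure_semi_sigma_additive.
by apply: is_cvg_nneseries => *; exact: mixture_ge0.
Qed.

HB.instance Definition _ := isMeasure.Build _ _ _
  (mixture mk) mixture0 mixture_ge0 mixture_sigma_additive.

End mixture_measure.

Lemma eq_ge0_integral_mixture d1 d2 d3 (T1 : measurableType d1)
    (T2 : measurableType d2) (T3 : measurableType d3) (R : realType)
    (mu1 : {measure set T1 -> \bar R}) (k1 : T1 -> {measure set T3 -> \bar R})
    (mu2 : {measure set T2 -> \bar R}) (k2 : T2 -> {measure set T3 -> \bar R})
    (f : T3 -> \bar R) :
  (forall U, measurable U -> measurable_fun setT (k1 ^~ U)) ->
  (forall U, measurable U -> measurable_fun setT (k2 ^~ U)) ->
  (forall A, measurable A -> \int[mu1]_x k1 x A = \int[mu2]_x k2 x A)%E ->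
  (forall z, 0 <= f z)%E -> measurable_fun setT f ->
  (\int[mu1]_x \int[k1 x]_z f z = \int[mu2]_x \int[k2 x]_z f z)%E.
Proof.
move=> mk1 mk2 kE f0 mf.
rewrite -(ge0_integral_mixture (mu := mu1) (nu := mixture mu1 mk1) mk1)//.
exact: (ge0_integral_mixture (mu := mu2) (nu := mixture mu1 mk1) mk2).
Qed.

Section likelihood_ratio.
Context (R : realType).
Variable sigma : R.
Hypothesis sigma_gt0 : 0 < sigma.

(** The density of N(x, sigma^2) with respect to N(t, sigma^2), at y. *)
Definition lik_ratio (t x y : R) : R :=
  gauss (2 * sigma ^+ 2) (y - x) / gauss (2 * sigma ^+ 2) (y - t).

Lemma lik_ratio_gt0 t x y : 0 < lik_ratio t x y.
Proof. by rewrite divr_gt0// expR_gt0. Qed.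

Lemma gauss_lik_ratio t x y :
  gauss (2 * sigma ^+ 2) (y - t) * lik_ratio t x y =
  gauss (2 * sigma ^+ 2) (y - x).
Proof. by rewrite mulrC divfK// gt_eqF// expR_gt0. Qed.

Lemma measurable_lik_ratio t :
  measurable_fun setT (fun xy : R * R => lik_ratio t xy.1 xy.2).
Proof.
apply: measurable_funM.
  apply: (measurableT_comp (@measurable_gauss R _)).
  exact: measurable_funB.
apply: (measurableT_comp (@measurable_invr R)).
apply: (measurableT_comp (@measurable_gauss R _)).
exact: measurable_funB.
Qed.

Lemma normal_prob_lik_ratio t x (f : R -> \bar R) :
  (forall y, 0 <= f y)%E -> measurable_fun setT f ->
  (\int[normal_prob x sigma]_y f y =
   \int[normal_prob t sigma]_y ((lik_ratio t x y)%:E * f y))%E.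
Proof.
move=> f0 mf; rewrite !ge0_integral_normal_prob//.
- apply: eq_integral => y _.
  rewrite !normal_pdf_gauss// muleA -EFinM; congr (_%:E * _)%E.
  by rewrite -[RHS]mulrA gauss_lik_ratio.
- by move=> y; rewrite mule_ge0// lee_fin ltW// lik_ratio_gt0.
- apply: emeasurable_funM => //; apply/measurable_EFinP.
  exact: (measurableT_comp (measurable_lik_ratio t) (measurable_pair1 x)).
Qed.

Lemma integral_lik_ratio tau t y (f : R -> R) :
  (forall x, 0 <= f x) -> measurable_fun setT f ->
  (\int[horseshoe_prob sigma tau]_x (f x * lik_ratio t x y)%:E =
   ((gauss (2 * sigma ^+ 2) (y - t))^-1)%:E *
   \int[horseshoe_prob sigma tau]_x (f x * gauss (2 * sigma ^+ 2) (y - x))%:E)%E.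
Proof.
move=> f0 mf; rewrite -horseshoe_integralZl.
- by apply: eq_integral => x _; rewrite -EFinM /lik_ratio mulrA mulrC.
- by rewrite invr_ge0 gauss_ge0.
- by move=> x; rewrite mulr_ge0 ?gauss_ge0.
- by apply: measurable_funM => //; exact: measurable_gauss_shift.
Qed.

End likelihood_ratio.

Section posterior_density.
Context (R : realType) (n : nat).
Variables (sigma tau : R) (theta0 : rvec R n).
Hypothesis sigma_gt0 : 0 < sigma.
Hypothesis tau01 : 0 < tau <= 1.

Let P0 := normal_vector theta0 sigma.
Let prior : probability (rvec R n) R := horseshoe_prior n sigma tau.

(** The density of N(theta, sigma^2 I) with respect to N(theta0, sigma^2 I). *)
Definition lik (theta y : rvec R n) : R :=
  \prod_(i < n) lik_ratio sigma (coord theta0 i) (coord theta i) (coord y i).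

Lemma lik_gt0 theta y : 0 < lik theta y.
Proof. by apply: prodr_gt0 => i _; exact: lik_ratio_gt0. Qed.

Let lik_ge0 theta y : 0 <= lik theta y. Proof. exact/ltW/lik_gt0. Qed.

Lemma measurable_coord i : measurable_fun setT (fun y : rvec R n => coord y i : R).
Proof. exact: (measurable_tnth i). Qed.

Lemma measurable_lik :
  measurable_fun setT (fun ty : rvec R n * rvec R n => lik ty.1 ty.2).
Proof.
apply: measurable_prod => i _.
have m : measurable_fun setT
    (fun ty : rvec R n * rvec R n => (coord ty.1 i, coord ty.2 i) : R * R).
  apply: measurable_fun_pair.
    exact: (measurableT_comp (measurable_coord i) measurable_fst).
  exact: (measurableT_comp (measurable_coord i) measurable_snd).
exact: (measurableT_comp (measurable_lik_ratio sigma (coord theta0 i)) m).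
Qed.

Lemma measurable_lik1 theta : measurable_fun setT (lik theta).
Proof. exact: (measurableT_comp measurable_lik (measurable_pair1 theta)). Qed.

Lemma measurable_lik2 y : measurable_fun setT (lik ^~ y).
Proof. exact: (measurableT_comp measurable_lik (measurable_pair2 y)). Qed.

Lemma normal_vector_lik theta (f : rvec R n -> \bar R) :
  (forall y, 0 <= f y)%E -> measurable_fun setT f ->
  (\int[normal_vector theta sigma]_y f y = \int[P0]_y ((lik theta y)%:E * f y))%E.
Proof.
move=> f0 mf.
pose l i := lik_ratio sigma (coord theta0 i) (coord theta i).
have l0 i x : 0 <= l i x by exact/ltW/lik_ratio_gt0.
have ml i : measurable_fun setT (l i : measurableTypeR R -> R).
  exact: (measurableT_comp (measurable_lik_ratio sigma _) (measurable_pair1 _)).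
apply: (@ge0_integral_product_prob_density _ (measurableTypeR R) R n
  (fun i => normal_prob (coord theta0 i) sigma)
  (fun i => normal_prob (coord theta i) sigma) l f l0 ml _ f0 mf).
by move=> i g g0 mg; exact: normal_prob_lik_ratio.
Qed.

(** The marginal density of the observation with respect to
    N(theta0, sigma^2 I), which is the denominator in Bayes' formula. *)
Definition evidence (y : rvec R n) : \bar R := (\int[prior]_theta (lik theta y)%:E)%E.

Lemma measurable_evidence : measurable_fun setT evidence.
Proof.
apply: (measurable_fun_fubini_tonelli_G (m1 := prior)
  (fun ty : rvec R n * rvec R n => (lik ty.1 ty.2)%:E)).
  by apply/measurable_EFinP; exact: measurable_lik.
by move=> ty; rewrite lee_fin.
Qed.

(** Prior and likelihood are both products over the coordinates. *)
Lemma prior_lik_prod (F : 'I_n -> R -> R) y :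
  (forall i x, 0 <= F i x) -> (forall i, measurable_fun setT (F i)) ->
  (\int[prior]_theta ((\prod_(i < n) F i (coord theta i)) * lik theta y)%:E =
   \big[*%E/1%E]_(i < n) (\int[horseshoe_prob sigma tau]_x
     (F i x * lik_ratio sigma (coord theta0 i) x (coord y i))%:E))%E.
Proof.
move=> F0 mF.
pose f i x := (F i x * lik_ratio sigma (coord theta0 i) x (coord y i))%:E.
have f0 i x : (0 <= f i x)%E.
  by rewrite lee_fin mulr_ge0// ltW// lik_ratio_gt0.
have mf i : measurable_fun setT (f i : measurableTypeR R -> \bar R).
  apply/measurable_EFinP; apply: measurable_funM; first exact: mF.
  exact: (measurableT_comp (measurable_lik_ratio sigma _) (measurable_pair2 _)).
rewrite -(@ge0_integral_product_prob_prod _ (measurableTypeR R) R n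
  (fun=> horseshoe_prob sigma tau) f f0 mf).
by apply: eq_integral => theta _; rewrite prodEFin -big_split.
Qed.

Lemma evidenceE y : evidence y =
  \big[*%E/1%E]_(i < n) (\int[horseshoe_prob sigma tau]_x
     (lik_ratio sigma (coord theta0 i) x (coord y i))%:E)%E.
Proof.
have := @prior_lik_prod (fun _ _ => 1) y (fun _ _ => ler01) (fun=> measurable_cst _).
under eq_integral do rewrite big1// mul1r.
rewrite /evidence => ->; apply: eq_bigr => i _.
by apply: eq_integral => x _; rewrite mul1r.
Qed.

Lemma evidence_factorE t x :
  (\int[horseshoe_prob sigma tau]_z (lik_ratio sigma t z x)%:E =
   ((gauss (2 * sigma ^+ 2) (x - t))^-1)%:E * marginal_lik sigma tau x)%E.
Proof.
have := @integral_lik_ratio _ sigma tau t x (fun=> 1) (fun=> ler01)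
  (measurable_cst _).
under eq_integral do rewrite mul1r.
move=> ->; congr (_ * _)%E.
by apply: eq_integral => z _; rewrite mul1r.
Qed.

Lemma evidence_factor_gt0 t x :
  (0 < \int[horseshoe_prob sigma tau]_z (lik_ratio sigma t z x)%:E)%E.
Proof.
rewrite evidence_factorE; apply: mule_gt0.
  by rewrite lte_fin invr_gt0 expR_gt0.
have [c c0 cP] := marginal_lik_lb_gauss sigma_gt0.
by apply: lt_le_trans (cP _ _ tau01); rewrite lte_fin mulr_gt0// expR_gt0.
Qed.

Lemma evidence_factor_fin t x :
  (\int[horseshoe_prob sigma tau]_z (lik_ratio sigma t z x)%:E)%E \is a fin_num.
Proof. by rewrite evidence_factorE fin_numM// marginal_lik_fin. Qed.

(** Together with finiteness, this is what allows dividing by the evidence. *)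
Lemma evidence_gt0 y : (0 < evidence y)%E.
Proof.
rewrite evidenceE; elim/big_ind : _ => // [x z|i _]; first exact: mule_gt0.
exact: evidence_factor_gt0.
Qed.

Lemma evidence_fin y : evidence y \is a fin_num.
Proof.
rewrite evidenceE; elim/big_ind : _ => // [x z|i _]; first exact: fin_numM.
exact: evidence_factor_fin.
Qed.

End posterior_density.

Section posterior_identity.
Context (R : realType) (n : nat).
Variables (sigma tau : R) (theta0 : rvec R n).
Hypothesis sigma_gt0 : 0 < sigma.
Hypothesis tau01 : 0 < tau <= 1.

Let P0 := normal_vector theta0 sigma.
Let prior : probability (rvec R n) R := horseshoe_prior n sigma tau.

Local Notation lik := (lik sigma theta0).
Local Notation evidence := (evidence sigma tau theta0).

Let lik_ge0 theta y : 0 <= lik theta y. Proof. exact/ltW/lik_gt0. Qed.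

(** All coordinates but the [i]-th contribute the same factor to the numerator
    and to the denominator of Bayes' formula. *)
Lemma lik_moment_coord (U : R -> R -> R) i y :
  (forall t z, (\int[horseshoe_prob sigma tau]_x
     ((x - t) ^+ 2 * gauss (2 * sigma ^+ 2) (z - x))%:E <=
     (U t z)%:E * marginal_lik sigma tau z)%E) ->
  (\int[prior]_theta
     ((coord theta i - coord theta0 i) ^+ 2 * lik theta y)%:E <=
   (U (coord theta0 i) (coord y i))%:E * evidence y)%E.
Proof.
move=> HU; set t := coord theta0 i; set z := coord y i.
pose F j (x : R) := if j == i then (x - t) ^+ 2 else 1.
have F0 j x : 0 <= F j x by rewrite /F; case: ifPn => // _; exact: sqr_ge0.
have mF j : measurable_fun setT (F j).
  rewrite /F; case: (j == i); last exact: measurable_cst.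
  by apply: measurable_funX; exact: measurable_funB.
rewrite (_ : (\int[_]_theta _)%E =
    (\int[prior]_theta ((\prod_(j < n) F j (coord theta j)) * lik theta y)%:E)%E);
  last first.
  apply: eq_integral => theta _; congr (_ * _)%:E.
  rewrite (bigD1 i)//= big1 ?mulr1; first by rewrite /F eqxx.
  by move=> j /negbTE ji; rewrite /F ji.
rewrite prior_lik_prod// evidenceE (bigD1 i)//= [in leRHS](bigD1 i)//= muleA.
rewrite (eq_bigr (fun j => (\int[horseshoe_prob sigma tau]_x
    (lik_ratio sigma (coord theta0 j) x (coord y j))%:E)%E)); last first.
  move=> j /negbTE ji; apply: eq_integral => x _.
  by rewrite /F ji mul1r.
apply: lee_wpmul2r.
  apply: prode_ge0 => j _.
  by apply: integral_ge0 => x _; rewrite lee_fin ltW// lik_ratio_gt0.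
under eq_integral do rewrite /F eqxx.
rewrite integral_lik_ratio; last 2 first.
- by move=> x; exact: sqr_ge0.
- by apply: measurable_funX; exact: measurable_funB.
rewrite evidence_factorE -/t -/z muleCA lee_wpmul2l//.
by rewrite lee_fin invr_ge0 gauss_ge0.
Qed.

Variable K : R.-pker rvec R n ~> rvec R n.
Hypothesis HK : is_posterior sigma tau K.

(** The numerator in Bayes' formula for the event [A]. *)
Definition joint_lik A y := (\int[prior]_theta (\1_A theta * lik theta y)%:E)%E.

Let mindic (A : set (rvec R n)) : measurable A ->
  measurable_fun setT (fun y => (\1_A y : R)%:E).
Proof. by move=> mA; apply/measurable_EFinP; exact: measurable_indic. Qed.

(** The defining identity of a posterior, with N(theta, sigma^2 I) written
    through its density and the order of integration exchanged on both
    sides. *)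
Lemma posterior_joint A B : measurable A -> measurable B ->
  (\int[P0]_(y in B) (K y A * evidence y) =
   \int[P0]_(y in B) joint_lik A y)%E.
Proof.
move=> mA mB.
have mK : measurable_fun setT (fun y => K y A) := measurable_kernel K A mA.
have L1 theta : (\int[normal_vector theta sigma]_(y in B) K y A =
    \int[P0]_y ((lik theta y)%:E * (K y A * (\1_B y)%:E)))%E.
  rewrite [LHS]integral_mkcond epatch_indic.
  apply: (@normal_vector_lik R n sigma theta0 sigma_gt0 theta
    (fun y => K y A * (\1_B y)%:E)%E).
  - by move=> y; rewrite mule_ge0// lee_fin.
  - by apply: emeasurable_funM => //; exact: mindic.
have L2 theta : normal_vector theta sigma B =
    (\int[P0]_y ((lik theta y)%:E * (\1_B y)%:E))%E.
  transitivity (\int[normal_vector theta sigma]_y (\1_B y)%:E)%E.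
    by rewrite integral_indic// setIT.
  by apply: (normal_vector_lik theta0) => //; exact: mindic.
have mlik : measurable_fun setT
    (fun ty : rvec R n * rvec R n => (lik ty.1 ty.2)%:E).
  by apply/measurable_EFinP; exact: measurable_lik.
have mliky y : measurable_fun setT (fun theta => (lik theta y)%:E).
  by apply/measurable_EFinP; exact: measurable_lik2.
have ind0 (C : set (rvec R n)) y : (0 <= (\1_C y : R)%:E)%E by rewrite lee_fin.
have lik0 theta y : (0 <= (lik theta y)%:E)%E by rewrite lee_fin.
have R1 : (\int[prior]_theta \int[normal_vector theta sigma]_(y in B) K y A =
    \int[P0]_(y in B) (K y A * evidence y))%E.
  under eq_integral do rewrite L1.
  pose F (ty : rvec R n * rvec R n) :=
    ((lik ty.1 ty.2)%:E * (K ty.2 A * (\1_B ty.2)%:E))%E.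
  have mF : measurable_fun setT F.
    apply: emeasurable_funM => //; apply: emeasurable_funM.
      exact: (measurableT_comp mK measurable_snd).
    exact: (measurableT_comp (mindic mB) measurable_snd).
  have F0 ty : (0 <= F ty)%E by rewrite !mule_ge0.
  rewrite (fubini_tonelli (m1 := prior) (m2 := P0) F mF F0).
  rewrite [RHS]integral_mkcond epatch_indic; apply: eq_integral => y _.
  rewrite /F/= ge0_integralZr ?mule_ge0//.
  by rewrite muleC muleAC.
have R2 : (\int[prior]_(theta in A) normal_vector theta sigma B =
    \int[P0]_(y in B) joint_lik A y)%E.
  rewrite [LHS]integral_mkcond epatch_indic.
  rewrite (_ : (\int[_]_theta _)%E = (\int[prior]_theta \int[P0]_y
     ((\1_A theta * lik theta y)%:E * (\1_B y)%:E))%E); last first.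
    apply: eq_integral => theta _ /=; rewrite L2 -ge0_integralZr//.
    - by apply: eq_integral => y _; rewrite muleAC EFinM (muleC (\1_A _)%:E).
    - apply: emeasurable_funM; last exact: mindic.
      by apply/measurable_EFinP; exact: measurable_lik1.
    - by move=> y _; rewrite mule_ge0.
  pose F (ty : rvec R n * rvec R n) :=
    ((\1_A ty.1 * lik ty.1 ty.2)%:E * (\1_B ty.2)%:E)%E.
  have mF : measurable_fun setT F.
    apply: emeasurable_funM; last first.
      exact: (measurableT_comp (mindic mB) measurable_snd).
    apply/measurable_EFinP; apply: measurable_funM; last exact: measurable_lik.
    have m1 : measurable_fun setT (\1_A : rvec R n -> R).
      exact: measurable_indic.
    exact: (measurableT_comp m1 measurable_fst).
  have F0 ty : (0 <= F ty)%E by rewrite mule_ge0// lee_fin mulr_ge0.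
  rewrite (fubini_tonelli (m1 := prior) (m2 := P0) F mF F0).
  rewrite [RHS]integral_mkcond epatch_indic; apply: eq_integral => y _.
  rewrite /F/= ge0_integralZr//.
  - apply/measurable_EFinP; apply: measurable_funM; last exact: measurable_lik2.
    exact: measurable_indic.
  - by move=> theta _; rewrite lee_fin mulr_ge0.
by rewrite -R1 -R2; exact: HK.
Qed.

End posterior_identity.

Section posterior_expectation.
Context (R : realType) (n : nat).
Variables (sigma tau : R) (theta0 : rvec R n).
Hypothesis sigma_gt0 : 0 < sigma.
Hypothesis tau01 : 0 < tau <= 1.

Let P0 := normal_vector theta0 sigma.
Let prior : probability (rvec R n) R := horseshoe_prior n sigma tau.

Local Notation lik := (lik sigma theta0).
Local Notation evidence := (evidence sigma tau theta0).
Local Notation joint_lik := (joint_lik sigma tau theta0).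

Let lik_ge0 theta y : 0 <= lik theta y. Proof. exact/ltW/lik_gt0. Qed.

Let evidence_ge0 y : (0 <= evidence y)%E.
Proof. by apply: integral_ge0 => theta _; rewrite lee_fin. Qed.

Let mlik : measurable_fun setT
  (fun ty : rvec R n * rvec R n => (lik ty.1 ty.2)%:E).
Proof. by apply/measurable_EFinP; exact: measurable_lik. Qed.

Lemma integral_evidence : (\int[P0]_y evidence y = 1)%E.
Proof.
pose F (ty : rvec R n * rvec R n) := (lik ty.1 ty.2)%:E.
have F0 ty : (0 <= F ty)%E by rewrite lee_fin.
transitivity (\int[prior]_theta \int[P0]_y F (theta, y))%E.
  by rewrite (fubini_tonelli (m1 := prior) (m2 := P0) F mlik F0).
transitivity (\int[prior]_theta 1)%E; last first.
  by rewrite integral_cst// mul1e; exact: probability_setT.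
apply: eq_integral => theta _.
transitivity (\int[normal_vector theta sigma]_y 1)%E; last first.
  by rewrite integral_cst// mul1e; exact: probability_setT.
have f0 (y : rvec R n) : (0 <= (cst 1 y : \bar R))%E by [].
apply/esym; apply: (etrans
  (@normal_vector_lik R n sigma theta0 sigma_gt0 theta _ f0 (measurable_cst _))).
by apply: eq_integral => y _; rewrite mule1.
Qed.

Variable K : R.-pker rvec R n ~> rvec R n.
Hypothesis HK : is_posterior sigma tau K.

Lemma measurable_joint_lik A : measurable A -> measurable_fun setT (joint_lik A).
Proof.
move=> mA; apply: (measurable_fun_fubini_tonelli_G (m1 := prior)
  (fun ty : rvec R n * rvec R n => (\1_A ty.1 * lik ty.1 ty.2)%:E)).
  apply/measurable_EFinP; apply: measurable_funM; last exact: measurable_lik.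
  have m1 : measurable_fun setT (\1_A : rvec R n -> R).
    exact: measurable_indic.
  exact: (measurableT_comp m1 measurable_fst).
by move=> ty; rewrite lee_fin mulr_ge0.
Qed.

(** By [posterior_joint] the two functions have the same integral over every
    measurable set, and they are integrable because the evidence has integral
    1. *)
Lemma posterior_ae A : measurable A ->
  ae_eq P0 setT (fun y => K y A * evidence y)%E (joint_lik A).
Proof.
move=> mA.
have mK : measurable_fun setT (fun y => K y A) := measurable_kernel K A mA.
have mf : measurable_fun setT (fun y => K y A * evidence y)%E.
  by apply: emeasurable_funM => //; exact: measurable_evidence.
apply: integral_ae_eq => //.
- apply/integrableP; split => //.
  apply: (@le_lt_trans _ _ (\int[P0]_y evidence y)%E); last first.
    by rewrite integral_evidence ltry.
  apply: ge0_le_integralT => y; first exact: abse_ge0.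
  rewrite gee0_abs ?mule_ge0// -[leRHS]mul1e lee_wpmul2r//.
  by apply: (le_trans _ (sprob_kernel_le1 K y)); apply: le_measure; rewrite ?inE.
- exact: measurable_joint_lik.
- by move=> B _ mB; exact: posterior_joint.
Qed.

Let post (ty : rvec R n * rvec R n) : R :=
  (fine (evidence ty.2))^-1 * lik ty.1 ty.2.

Let ev_inv y : R := (fine (evidence y))^-1.

Let ev_inv_ge0 y : 0 <= ev_inv y.
Proof. by rewrite invr_ge0 fine_ge0. Qed.

Let mev_inv : measurable_fun setT ev_inv.
Proof.
apply: (measurableT_comp (@measurable_invr R)).
by apply: measurableT_comp => //; exact: measurable_evidence.
Qed.

Let post_ge0 ty : 0 <= post ty.
Proof. by apply: mulr_ge0; [exact: ev_inv_ge0|exact: lik_ge0]. Qed.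

Let mpost : measurable_fun setT post.
Proof.
apply: measurable_funM; last exact: measurable_lik.
exact: (measurableT_comp mev_inv measurable_snd).
Qed.

(** The right-hand side is an integral over pairs (theta, y), so that
    [eq_ge0_integral_mixture] applies, with real weights carried by Dirac
    masses. *)
Lemma bayes_set A : measurable A ->
  (\int[P0]_y K y A =
   \int[(prior \x P0)%E]_ty ((post ty)%:E * (\1_A ty.1)%:E))%E.
Proof.
move=> mA.
have mK : measurable_fun setT (fun y => K y A) := measurable_kernel K A mA.
transitivity (\int[P0]_y ((ev_inv y)%:E * joint_lik A y))%E.
  apply: ge0_ae_eq_integral => //.
  - apply: emeasurable_funM; first exact/measurable_EFinP.
    exact: measurable_joint_lik.
  - move=> y _; rewrite mule_ge0 ?lee_fin//.
    by apply: integral_ge0 => theta _; rewrite lee_fin mulr_ge0.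
  - move: (posterior_ae mA); apply: filterS => y /= H _.
    have evK : ((ev_inv y)%:E * evidence y = 1)%E.
      have fev : evidence y \is a fin_num by exact: evidence_fin.
      have ev0 : (0 < evidence y)%E by exact: evidence_gt0.
      rewrite -(fineK fev) -EFinM mulVf// gt_eqF// fine_gt0//.
      by rewrite ev0/= ltey_eq fev.
    by rewrite -H// muleCA evK mule1.
pose F (ty : rvec R n * rvec R n) := ((post ty)%:E * (\1_A ty.1)%:E)%E.
have F0 ty : (0 <= F ty)%E by rewrite mule_ge0 ?lee_fin.
have FE ty : F ty = ((ev_inv ty.2)%:E * (\1_A ty.1 * lik ty.1 ty.2)%:E)%E.
  by rewrite /F -!EFinM /post -mulrA (mulrC (lik _ _)).
have mF : measurable_fun setT F.
  apply: emeasurable_funM; first exact/measurable_EFinP.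
  have m1 : measurable_fun setT (\1_A : rvec R n -> R).
    exact: measurable_indic.
  by apply/measurable_EFinP; exact: (measurableT_comp m1 measurable_fst).
rewrite -[RHS]/(\int[(prior \x P0)%E]_ty F ty)%E.
rewrite (fubini_tonelli2 (m1 := prior) (m2 := P0) F mF F0).
apply: eq_integral => y _; rewrite /fubini_G.
under eq_integral do rewrite FE/=.
rewrite ge0_integralZl//.
- apply/measurable_EFinP; apply: measurable_funM; last exact: measurable_lik2.
  exact: measurable_indic.
- by move=> theta _; rewrite lee_fin mulr_ge0.
- by rewrite lee_fin ev_inv_ge0.
Qed.

(** The exceptional null set in [posterior_ae] depends on the event;
    integrating over y first makes it harmless when passing from events to
    functions. *)
Lemma bayes_integral (f : rvec R n -> R) :
  (forall theta, 0 <= f theta) -> measurable_fun setT f ->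
  (\int[P0]_y \int[K y]_theta (f theta)%:E =
   \int[P0]_y ((ev_inv y)%:E *
     \int[prior]_theta (f theta * lik theta y)%:E))%E.
Proof.
move=> f0 mf.
pose k ty : {measure set (rvec R n) -> \bar R} :=
  mscale (NngNum (post_ge0 ty)) (dirac ty.1).
have kE ty A : k ty A = ((post ty)%:E * (\1_A ty.1)%:E)%E.
  by rewrite /k /= /mscale/= diracE indicE.
have mEf : measurable_fun setT (fun theta => (f theta)%:E).
  exact/measurable_EFinP.
rewrite (@eq_ge0_integral_mixture _ _ _ _ _ _ R P0 K (prior \x P0)%E k)//.
- pose F (ty : rvec R n * rvec R n) := ((post ty)%:E * (f ty.1)%:E)%E.
  have F0 ty : (0 <= F ty)%E by rewrite mule_ge0 ?lee_fin.
  have mF : measurable_fun setT F.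
    apply: emeasurable_funM; first exact/measurable_EFinP.
    exact: (measurableT_comp mEf measurable_fst).
  transitivity (\int[(prior \x P0)%E]_ty F ty)%E.
    apply: eq_integral => ty _; rewrite ge0_integral_mscale//=; last first.
      by move=> theta _; rewrite lee_fin.
    by rewrite integral_dirac// diracT mul1e.
  rewrite (fubini_tonelli2 (m1 := prior) (m2 := P0) F mF F0).
  apply: eq_integral => y _; rewrite /fubini_G -ge0_integralZl//.
  + apply: eq_integral => theta _.
    by rewrite -!EFinM /F/= -!EFinM /post -mulrA (mulrC (f _)).
  + apply/measurable_EFinP; apply: measurable_funM => //.
    exact: measurable_lik2.
  + by move=> theta _; rewrite lee_fin mulr_ge0.
  + by rewrite lee_fin ev_inv_ge0.
- by move=> U mU; exact: measurable_kernel.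
- move=> U mU; under eq_fun do rewrite kE.
  apply: emeasurable_funM; first exact/measurable_EFinP.
  have m1 : measurable_fun setT (\1_U : rvec R n -> R).
    exact: measurable_indic.
  by apply/measurable_EFinP; exact: (measurableT_comp m1 measurable_fst).
- by move=> A mA; rewrite bayes_set//.
Qed.

Lemma measurable_sqr_coordB i (c : R) :
  measurable_fun setT (fun theta : rvec R n => (coord theta i - c) ^+ 2).
Proof.
apply: measurable_funX; apply: measurable_funB => //.
exact: measurable_coord.
Qed.

(** By [lik_moment_coord] the evidence cancels in each term of Bayes' formula,
    which leaves the explicit function [U] of y_i; and y_i has law
    N(theta0_i, sigma^2). *)
Lemma posterior_risk_le (U : R -> R -> R) :
  (forall t y, 0 <= U t y) ->
  (forall t, measurable_fun setT (U t)) ->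
  (forall t z, (\int[horseshoe_prob sigma tau]_x
     ((x - t) ^+ 2 * gauss (2 * sigma ^+ 2) (z - x))%:E <=
     (U t z)%:E * marginal_lik sigma tau z)%E) ->
  (\int[P0]_y \int[K y]_theta
     (\sum_(i < n) (coord theta i - coord theta0 i) ^+ 2)%:E <=
   \sum_(i < n) \int[normal_prob (coord theta0 i) sigma]_z
     (U (coord theta0 i) z)%:E)%E.
Proof.
move=> U0 mU HU.
pose f theta := \sum_(i < n) (coord theta i - coord theta0 i) ^+ 2.
have f0 theta : 0 <= f theta by apply: sumr_ge0 => i _; exact: sqr_ge0.
have mf : measurable_fun setT f.
  by apply: measurable_sum => i; exact: measurable_sqr_coordB.
rewrite (bayes_integral f0 mf).
have mUi i : measurable_fun setT
    (fun y : rvec R n => (U (coord theta0 i) (coord y i))%:E).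
  by apply/measurable_EFinP; exact: (measurableT_comp (mU _) (measurable_coord i)).
apply: (@le_trans _ _ (\int[P0]_y
    (\sum_(i < n) (U (coord theta0 i) (coord y i))%:E))%E); last first.
  rewrite ge0_integral_sum//; last by move=> i y _; rewrite lee_fin.
  apply: lee_sum => i _.
  have h0 z : (0 <= (U (coord theta0 i) z)%:E)%E by rewrite lee_fin.
  have hm : measurable_fun setT
      (fun z : measurableTypeR R => (U (coord theta0 i) z)%:E).
    by apply/measurable_EFinP; exact: mU.
  by rewrite (@ge0_integral_product_prob_tnth _ (measurableTypeR R) R n
    (fun i => normal_prob (coord theta0 i) sigma) i _ h0 hm).
apply: ge0_le_integralT => y.
  rewrite mule_ge0 ?lee_fin//.
  by apply: integral_ge0 => theta _; rewrite lee_fin mulr_ge0.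
rewrite (_ : (\int[prior]_theta _)%E = (\sum_(i < n) \int[prior]_theta
    ((coord theta i - coord theta0 i) ^+ 2 * lik theta y)%:E)%E); last first.
  rewrite -ge0_integral_sum//.
  - by apply: eq_integral => theta _; rewrite sumEFin mulr_suml.
  - move=> i; apply/measurable_EFinP; apply: measurable_funM.
      exact: measurable_sqr_coordB.
    exact: measurable_lik2.
  - by move=> i theta _; rewrite lee_fin mulr_ge0// sqr_ge0.
rewrite ge0_sume_distrr; last first.
  by move=> i _; apply: integral_ge0 => theta _; rewrite lee_fin mulr_ge0// sqr_ge0.
apply: lee_sum => i _.
have fev : evidence y \is a fin_num by exact: evidence_fin.
have ev0 : (0 < evidence y)%E by exact: evidence_gt0.
apply: (@le_trans _ _ ((ev_inv y)%:E *
    ((U (coord theta0 i) (coord y i))%:E * evidence y))%E).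
  rewrite lee_wpmul2l ?lee_fin//; exact: lik_moment_coord.
rewrite muleCA -(fineK fev) -!EFinM mulVf ?mulr1//.
by rewrite gt_eqF// fine_gt0// ev0/= ltey_eq fev.
Qed.

End posterior_expectation.

(** * From second moments to contraction *)

Section moments.
Context d (T : measurableType d) (R : realType) (Q : {measure set T -> \bar R}).
Hypothesis Q1 : Q setT = 1%E.

Let integral_cstQ (a : R) : (\int[Q]__ a%:E = a%:E)%E.
Proof. by rewrite integral_cst// Q1 mule1. Qed.

Let integrable_cstQ (a : R) : Q.-integrable setT (fun=> a%:E).
Proof.
apply/integrableP; split; first exact: measurable_cst.
by under eq_integral do rewrite /=; rewrite integral_cstQ ltry.
Qed.

(** The second moment around [a] exceeds the variance by the square of the
    bias; if it is infinite there is nothing to prove. *)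
Lemma second_moment_center_le (X : T -> R) (a : R) : measurable_fun setT X ->
  (\int[Q]_x ((X x - \int[Q]_z X z) ^+ 2)%:E <=
   \int[Q]_x ((X x - a) ^+ 2)%:E)%E.
Proof.
move=> mX; pose Z x := X x - a.
have mZ : measurable_fun setT Z by exact: measurable_funB.
have mZ2 : measurable_fun setT (fun x => Z x ^+ 2) by exact: measurable_funX.
have Z20 x : (0 <= (Z x ^+ 2)%:E)%E by rewrite lee_fin sqr_ge0.
have [Zoo|] := ltP (\int[Q]_x (Z x ^+ 2)%:E)%E +oo%E; last first.
  by rewrite leye_eq => /eqP ->; rewrite leey.
have iZ2 : Q.-integrable setT (fun x => (Z x ^+ 2)%:E).
  apply/integrableP; split; first exact/measurable_EFinP.
  by under eq_integral do rewrite gee0_abs//.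
have iZ : Q.-integrable setT (fun x => (Z x)%:E).
  apply/integrableP; split; first exact/measurable_EFinP.
  apply: (@le_lt_trans _ _ (\int[Q]_x (1%:E + (Z x ^+ 2)%:E))%E).
    apply: ge0_le_integralT => x; first exact: abse_ge0.
    rewrite abse_EFin -EFinD lee_fin -(real_normK (num_real (Z x))).
    by have := sqr_ge0 (`|Z x| - 1); have := normr_ge0 (Z x); nra.
  rewrite ge0_integralD//; last exact/measurable_EFinP.
  by rewrite integral_cstQ lte_add_pinfty// ltry.
have fZ : (\int[Q]_x (Z x)%:E)%E \is a fin_num by exact: integrable_fin_num.
pose c := fine (\int[Q]_x (Z x)%:E)%E.
have cE : (\int[Q]_x (Z x)%:E = c%:E)%E by rewrite fineK.
have EX : \int[Q]_z X z = c + a.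
  rewrite /Rintegral (_ : (\int[Q]_x _)%E =
      (\int[Q]_x ((Z x)%:E + a%:E))%E); last first.
    by apply: eq_integral => x _; rewrite -EFinD subrK.
  by rewrite integralD// cE integral_cstQ.
rewrite EX (_ : (\int[Q]_x _)%E = (\int[Q]_x
    ((Z x ^+ 2)%:E + ((- (2 * c))%:E * (Z x)%:E + (c ^+ 2)%:E)))%E); last first.
  by apply: eq_integral => x _; rewrite -EFinM -!EFinD /Z; congr EFin; ring.
have icZ : Q.-integrable setT (fun x => (- (2 * c))%:E * (Z x)%:E)%E.
  exact: integrableZl.
rewrite integralD//; last by apply: integrableD.
rewrite integralD// integralZl// cE integral_cstQ -EFinM -EFinD.
rewrite -[leRHS]adde0 leeD2l// lee_fin.
by have := sqr_ge0 c; nra.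
Qed.

Lemma markov_gt (f : T -> R) (r : R) : 0 < r -> (forall x, 0 <= f x) ->
  measurable_fun setT f ->
  (Q [set x | (r < f x)%R] <= (r^-1)%:E * \int[Q]_x (f x)%:E)%E.
Proof.
move=> r0 f0 mf.
have mA : measurable [set x | r < f x].
  rewrite -[X in measurable X]setTI.
  rewrite (_ : [set x | r < f x] = f @^-1` `]r, +oo[); last first.
    by apply/seteqP; split => x /=; rewrite in_itv/= andbT.
  exact: mf.
rewrite -ge0_integralZl//; last 3 first.
- exact/measurable_EFinP.
- by move=> x _; rewrite lee_fin.
- by rewrite lee_fin invr_ge0 ltW.
rewrite -[in leLHS](setIT [set x | r < f x]) -integral_indic//.
apply: ge0_le_integralT => x; first by rewrite lee_fin.
rewrite -EFinM lee_fin indicE; case: (boolP (x \in _)) => [|_]; last first.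
  by rewrite mulr_ge0// invr_ge0 ltW.
by rewrite inE/= => rf; rewrite mulrC ler_pdivlMr// mul1r ltW.
Qed.

End moments.

Section posterior_contraction.
Context (R : realType) (n : nat).

Lemma euclidean_dist2E (theta theta' : rvec R n) :
  euclidean_dist theta theta' ^+ 2 =
  \sum_(i < n) (coord theta i - coord theta' i) ^+ 2.
Proof. by rewrite sqr_sqrtr// sumr_ge0// => i _; exact: sqr_ge0. Qed.

Lemma measurable_euclidean_dist2 (theta' : rvec R n) :
  measurable_fun setT (fun theta : rvec R n => euclidean_dist theta theta' ^+ 2).
Proof.
under eq_fun do rewrite euclidean_dist2E.
by apply: measurable_sum => i; exact: measurable_sqr_coordB.
Qed.

Variable K : R.-pker rvec R n ~> rvec R n.

Lemma posterior_mean_dist_le (theta0 y : rvec R n) :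
  (\int[K y]_theta (euclidean_dist theta (posterior_mean K y) ^+ 2)%:E <=
   \int[K y]_theta (euclidean_dist theta theta0 ^+ 2)%:E)%E.
Proof.
have sumE theta' : (\int[K y]_theta (euclidean_dist theta theta' ^+ 2)%:E =
    \sum_(i < n) \int[K y]_theta ((coord theta i - coord theta' i) ^+ 2)%:E)%E.
  rewrite -ge0_integral_sum//.
  - by apply: eq_integral => theta _; rewrite euclidean_dist2E sumEFin.
  - by move=> i; apply/measurable_EFinP; exact: measurable_sqr_coordB.
  - by move=> i theta _; rewrite lee_fin sqr_ge0.
rewrite !sumE; apply: lee_sum => i _.
have -> : coord (posterior_mean K y) i = \int[K y]_theta coord theta i.
  by rewrite {1}/coord /posterior_mean tnth_mktuple.
apply: second_moment_center_le; first exact: prob_kernel.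
exact: measurable_coord.
Qed.

Let dist_risk (theta0 : rvec R n) y : \bar R :=
  (\int[K y]_theta (euclidean_dist theta theta0 ^+ 2)%:E)%E.

Let measurable_dist_risk theta0 : measurable_fun setT (dist_risk theta0).
Proof.
apply: measurable_fun_integral_kernel.
- by move=> U mU; exact: measurable_kernel.
- by move=> theta; rewrite lee_fin sqr_ge0.
- by apply/measurable_EFinP; exact: measurable_euclidean_dist2.
Qed.

(** Markov's inequality at each y, for a ball whose centre may depend on y.
    With such a centre the integrand on the left is only compared with a
    measurable one, by [ge0_le_integralT]. *)
Lemma posterior_tail_le (P0 : {measure set (rvec R n) -> \bar R})
    (theta0 : rvec R n) (center : rvec R n -> rvec R n) (r : R) : 0 < r ->
  (forall y, \int[K y]_theta (euclidean_dist theta (center y) ^+ 2)%:E <=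
    \int[K y]_theta (euclidean_dist theta theta0 ^+ 2)%:E)%E ->
  (\int[P0]_y K y [set theta | (r < euclidean_dist theta (center y) ^+ 2)%R] <=
   (r^-1)%:E *
   \int[P0]_y \int[K y]_theta (euclidean_dist theta theta0 ^+ 2)%:E)%E.
Proof.
move=> r0 H.
have rV0 : (0 <= (r^-1)%:E)%E by rewrite lee_fin invr_ge0 ltW.
have D0 y : (0 <= dist_risk theta0 y)%E.
  by apply: integral_ge0 => theta _; rewrite lee_fin sqr_ge0.
rewrite -(ge0_integralZl P0 measurableT (measurable_dist_risk theta0))//.
apply: ge0_le_integralT => y; first exact: measure_ge0.
apply: (@le_trans _ _ ((r^-1)%:E *
    \int[K y]_theta (euclidean_dist theta (center y) ^+ 2)%:E)%E).
  apply: markov_gt => //; first by move=> theta; exact: sqr_ge0.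
  exact: measurable_euclidean_dist2.
by rewrite lee_wpmul2l.
Qed.

End posterior_contraction.

Section uniform_risk.
Context (R : realType).
Variable sigma : R.
Hypothesis sigma_gt0 : 0 < sigma.

(** At most k coordinates have risk O(ln (1 / tau)), and all the others have
    risk O(tau ln (1 / tau)). *)
Lemma uniform_posterior_risk : exists2 C : R, 0 < C &
  forall n k tau (K : R.-pker rvec R n ~> rvec R n) (theta0 : rvec R n),
    0 < tau <= 2^-1 -> is_posterior sigma tau K -> l0_ball R n k theta0 ->
    (\int[normal_vector theta0 sigma]_y \int[K y]_theta
       (euclidean_dist theta theta0 ^+ 2)%:E <=
     (C * (k%:R + n%:R * tau) * ln tau^-1)%:E)%E.
Proof.
have [C C0 CP] := posterior_coordinate_risk sigma_gt0.
exists C => // n k tau K theta0 t12 HK hk; have /andP[t0 t2] := t12.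
have t1 : 0 < tau <= 1 by rewrite t0/= (le_trans t2)// invf_le1// ler1n.
have L0 : 0 < ln tau^-1.
  exact: lt_le_trans (ln2_gt0 R) (lnV_ge_ln2 t12).
have [U [U0 mU HU iU iU0]] := CP tau t12.
rewrite (_ : (\int[_]_y _)%E = (\int[normal_vector theta0 sigma]_y
    \int[K y]_theta (\sum_(i < n) (coord theta i - coord theta0 i) ^+ 2)%:E)%E);
  last first.
  apply: eq_integral => y _; apply: eq_integral => theta _.
  by rewrite euclidean_dist2E.
have H := posterior_risk_le theta0 sigma_gt0 t1 HK U0 mU HU.
apply: (le_trans H).
pose S := [set i : 'I_n | coord theta0 i != 0%R]%SET.
apply: (@le_trans _ _ (\sum_(i < n) ((if i \in S then C * ln tau^-1 else 0) +
    C * tau * ln tau^-1)%:E)%E).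
  apply: lee_sum => i _; case: ifPn; rewrite inE => hi.
    apply: (le_trans (iU _)); rewrite lee_fin lerDl.
    by rewrite mulr_ge0 ?(ltW L0)// mulr_ge0 ?(ltW C0) ?(ltW t0).
  by rewrite negbK in hi; rewrite (eqP hi) add0r.
rewrite sumEFin lee_fin big_split/= -big_mkcond/= !sumr_const card_ord.
rewrite mulrDr mulrDl; apply: lerD.
  rewrite -[leLHS]mulr_natl -[leRHS]mulrA [leRHS]mulrCA; apply: ler_wpM2r; last first.
    by rewrite ler_nat.
  by rewrite mulr_ge0 ?(ltW L0) ?(ltW C0).
by rewrite -[leLHS]mulr_natl le_eqVlt; apply/orP; left; apply/eqP; ring.
Qed.

End uniform_risk.

Lemma ereal_sup_cvg0 (R : realType) (S : nat -> set (\bar R)) (u : nat -> R) :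
  (\forall n \near \oo, S n !=set0 /\ forall x, S n x -> (0 <= x <= (u n)%:E)%E) ->
  u @ \oo --> (0 : R) -> (fun n => ereal_sup (S n)) @ \oo --> 0%E.
Proof.
move=> HS u0; apply: (@squeeze_cvge _ _ _ _ (cst 0%E) _ (fun n => (u n)%:E)).
- apply: filterS HS => n [[x Sx] Sn]; apply/andP; split.
    apply: (le_trans (proj1 (andP (Sn _ Sx)))).
    exact: ereal_sup_ubound.
  by apply: ge_ereal_sup => z /Sn/andP[].
- exact: cvg_cst.
- by apply: cvg_EFin => //; exact: nearW.
Qed.

Section rate.
Context (R : realType).

(** As alpha >= 1 and k / n <= 1, one has n tau <= k; and ln (1 / tau) is alpha
    times ln (n / k). *)
Lemma rate_le (C alpha M : R) (n k : nat) (tau := (k%:R / n%:R) `^ alpha)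
    (r := M * k%:R * ln (n%:R / k%:R)) :
  0 < C -> 1 <= alpha -> 0 < M -> (0 < k)%N -> k%:R <= 2^-1 * n%:R :> R ->
  [/\ 0 < tau <= 2^-1, 0 < r &
      r^-1 * (C * (k%:R + n%:R * tau) * ln tau^-1) <= 2 * C * alpha * M^-1].
Proof.
move=> C0 a1 M0 k0 kn.
have kR0 : 0 < k%:R :> R by rewrite ltr0n.
have nR0 : 0 < n%:R :> R by lra.
have a0 : 0 < alpha by exact: lt_le_trans a1.
pose q := k%:R / n%:R : R.
have q0 : 0 < q by rewrite divr_gt0.
have q2 : q <= 2^-1 by rewrite ler_pdivrMr.
have q1 : q <= 1 by rewrite (le_trans q2)// invf_le1// ler1n.
have tau0 : 0 < tau by exact: powR_gt0.
have tauq : tau <= q.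
  rewrite /tau -/q -[leRHS]powRr1 ?(ltW q0)//.
  by apply: ger_powR a1; rewrite q0.
have qV : n%:R / k%:R = q^-1 by rewrite invf_div.
have LE : ln tau^-1 = alpha * ln (n%:R / k%:R).
  by rewrite qV !lnV ?posrE// ln_powR mulrN.
have L0 : 0 < ln (n%:R / k%:R) :> R.
  by rewrite qV; apply: lt_le_trans (ln2_gt0 R) (lnV_ge_ln2 _); rewrite q0.
have r0 : 0 < r by rewrite !mulr_gt0.
split => //; first by rewrite tau0 (le_trans tauq).
rewrite mulrC ler_pdivrMr// LE.
rewrite (_ : 2 * C * alpha / M * r =
    C * (k%:R + k%:R) * (alpha * ln (n%:R / k%:R))); last first.
  by rewrite /r; field; rewrite gt_eqF.
apply: ler_wpM2r; first by rewrite mulr_ge0// ltW.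
rewrite ler_pM2l// lerD2l.
by rewrite mulrC -ler_pdivlMr.
Qed.

End rate.

Theorem theorem3p3 (R : realType) (sigma alpha : R)
    (sigma_gt0 : 0 < sigma) (alpha_ge1 : 1 <= alpha)
    (p : nat -> nat) (p_le : forall n, (p n <= n)%N)
    (p_infty : p @ \oo --> \oo)
    (p_small : (fun n => (p n)%:R : R^o) =o_\oo (fun n => n%:R : R^o))
    (Pi : forall n, R.-pker rvec R n ~> rvec R n)
    (Pi_posterior : forall n, (0 < p n)%N ->
       is_posterior sigma (((p n)%:R / n%:R) `^ alpha) (Pi n))
    (M : nat -> R) (M_infty : M @ \oo --> +oo) :
  (fun n => ereal_sup
     [set (\int[normal_vector theta0 sigma]_y
             Pi n y [set theta | (M n * (p n)%:R * ln (n%:R / (p n)%:R)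
                                  < euclidean_dist theta theta0 ^+ 2)%R])%E
     | theta0 in l0_ball R n (p n)]) @ \oo --> 0%E
  /\
  (fun n => ereal_sup
     [set (\int[normal_vector theta0 sigma]_y
             Pi n y [set theta | (M n * (p n)%:R * ln (n%:R / (p n)%:R)
                                  < euclidean_dist theta
                                      (posterior_mean (Pi n) y) ^+ 2)%R])%E
     | theta0 in l0_ball R n (p n)]) @ \oo --> 0%E.
Proof.
have [C C0 CP] := uniform_posterior_risk sigma_gt0.
pose u n := 2 * C * alpha * (M n)^-1.
have u0 : u @ \oo --> (0 : R).
  rewrite -[X in _ --> X](mulr0 (2 * C * alpha)).
  apply: cvgMr; apply/gtr0_cvgV0; last exact: M_infty.
  by move/cvgryPgt : M_infty; exact.
have near_n : \forall n \near \oo,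
    [/\ 0 < M n, (0 < p n)%N & (p n)%:R <= 2^-1 * n%:R :> R].
  near=> n; split.
  - by near: n; move/cvgryPgt : M_infty; exact.
  - by near: n; move/cvgnyPgt : p_infty; exact.
  - near: n; move/eqoP : p_small => /(_ 2^-1).
    rewrite invr_gt0 ltr0n => /(_ isT); apply: filterS => n.
    by rewrite !ger0_norm.
(* The zero vector makes the sets of values nonempty. *)
have zero_in_ball n k : l0_ball R n k [tuple 0 | _ < n].
  rewrite /l0_ball/= (_ : [set i | _]%SET = finset.set0) ?cards0//.
  by apply/setP => i; rewrite !inE /coord tnth_mktuple eqxx.
have tail n (center : rvec R n -> rvec R n -> rvec R n) :
    0 < M n -> (0 < p n)%N -> (p n)%:R <= 2^-1 * n%:R :> R ->
    (forall theta0 y,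
      \int[Pi n y]_theta (euclidean_dist theta (center theta0 y) ^+ 2)%:E <=
      \int[Pi n y]_theta (euclidean_dist theta theta0 ^+ 2)%:E)%E ->
    forall theta0, l0_ball R n (p n) theta0 ->
    (0 <= \int[normal_vector theta0 sigma]_y
       Pi n y [set theta | (M n * (p n)%:R * ln (n%:R / (p n)%:R)
                       < euclidean_dist theta (center theta0 y) ^+ 2)%R]
       <= (u n)%:E)%E.
  move=> M0 p0 pn Hc theta0 ball0; rewrite integral_ge0//=.
  have [tau12 r0 rle] := rate_le C0 alpha_ge1 M0 p0 pn.
  apply: (le_trans (posterior_tail_le _ r0 (Hc theta0))).
  apply: (le_trans (lee_wpmul2l _
    (CP _ _ _ _ _ tau12 (Pi_posterior _ p0) ball0))).
    by rewrite lee_fin invr_ge0 ltW.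
  by rewrite -EFinM lee_fin.
split; apply: (ereal_sup_cvg0 _ u0); apply: filterS near_n => n [M0 p0 pn];
  (split; first by eexists; exists [tuple 0 | _ < n]).
- move=> _ [theta0 ball0 <-].
  exact: (tail n (fun theta0 _ => theta0)).
- move=> _ [theta0 ball0 <-].
  apply: (tail n (fun _ y => posterior_mean (Pi n) y)) => // theta1 y.
  exact: posterior_mean_dist_le.
Unshelve. all: by end_near. Qed.
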